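(* Let $\mathbb{H}$ be a real separable Hilbert space, $A:\mathbb{H}\rightrightarrows\mathbb{H}$ a maximal monotone operator with $\mathrm{int}(\mathrm{Dom}(A))\neq\emptyset$, $x_0\in\overline{\mathrm{Dom}(A)}$, and $m:[0,\infty)\to\mathbb{H}$ continuous with $m(0)=0$. Then, for every $T>0$, the generalized convex Skorohod problem $$dx(t)+Ax(t)(dt)\ni dm(t),\qquad x(0)=x_0,$$ has a unique solution $(x,k)=\mathcal{GSP}(A;x_0,m)$ on $[0,T]$. Moreover, the following estimates hold: for every $T>0$ and every bounded equicontinuous subset $\mathcal{M}$ of $C([0,T];\mathbb{H})$ there exists a positive constant $C_{\mathcal{M}}$ such that, for all $x_0,\hat x_0\in\overline{\mathrm{Dom}(A)}$ and all $m,\hat m\in\mathcal{M}$ with $m(0)=\hat m(0)=0$, if $(x,k)=\mathcal{GSP}(A;x_0,m)$ and $(\hat x,\hat k)=\mathcal{GSP}(A;\hat x_0,\hat m)$ on $[0,T]$, then $$\|x\|_T^2+\mathrm{Var}_T(k)\le C_{\mathcal{M}}(1+|x_0|^2)$$ and $$\|x-\hat x\|_T\le C_{\mathcal{M}}\,(1+|x_0|+|\hat x_0|)\,\bigl(|x_0-\hat x_0|+\|m-\hat m\|_T^{1/2}\bigr).$$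
   Context: $|\cdot|$, $\langle\cdot,\cdot\rangle$ are the norm and scalar product of $\mathbb{H}$; $A$ is identified with its graph. $\|y\|_T=\sup_{t\in[0,T]}|y(t)|$, and $\mathrm{Var}_T(k)$ is the total variation of $k$ on $[0,T]$. $BV_0([0,T];\mathbb{H})$ is the set of functions $k:[0,T]\to\mathbb{H}$ with $\mathrm{Var}_T(k)<\infty$ and $k(0)=0$. $(x,k)=\mathcal{GSP}(A;x_0,m)$, i.e. $(x,k)$ is a solution of the generalized Skorohod problem on $[0,T]$, means: $x\in C([0,T];\mathbb{H})$, $x(t)\in\overline{\mathrm{Dom}(A)}$ for all $t\in[0,T]$, $k\in C([0,T];\mathbb{H})\cap BV_0([0,T];\mathbb{H})$, $x(t)+k(t)=x_0+m(t)$ for all $t\in[0,T]$, and $\int_s^t\langle x(r)-z,dk(r)-z^*dr\rangle\ge0$ for all $(z,z^* )\in A$ and $0\le s\le t\le T$. *)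

(* Defs.v *)
From mathcomp Require Import all_boot all_order all_algebra sesquilinear.
From mathcomp Require Import all_classical all_reals all_analysis.

Set Implicit Arguments.
Unset Strict Implicit.
Unset Printing Implicit Defensive.

Import Order.TTheory GRing.Theory Num.Theory.
Import numFieldNormedType.Exports.

Local Open Scope classical_set_scope.
Local Open Scope ring_scope.

(* Functions on [a, b] are represented by total functions on R whose values
   outside [a, b] are irrelevant. *)

Definition separable (T : topologicalType) : Prop :=
  exists2 D : set T, countable D & dense D.

Section vector_valued_paths.
Context {R : realType} {H : normedModType R}.
Implicit Types (a b : R) (f : R -> H) (s : seq R).

(* The vector-valued counterparts of the library's [variation],
   [total_variation], which are restricted to functions R -> R. *)
Definition vvariation a b f s : R :=
  let p := nth b (a :: s) in
  \sum_(0 <= i < size s) `|f (p i.+1) - f (p i)|.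

Definition vtotal_variation a b f : \bar R :=
  ereal_sup [set (vvariation a b f s)%:E | s in itv_partition a b].

(* [sup] of an unbounded set of reals is a dummy value: to be used on bounded
   paths only, e.g. on continuous ones. *)
Definition supnorm (T : R) f : R := sup [set `|f t| | t in `[0, T]].

Definition BV0 (T : R) : set (R -> H) :=
  [set k | (vtotal_variation 0 T k < +oo)%E /\ k 0 = 0].

Definition bounded_equicontinuous (T : R) (M : set (R -> H)) : Prop :=
  [/\ forall m, M m -> {within `[0, T], continuous m},
      exists K : R, forall m, M m -> supnorm T m <= K
    & equicontinuous M (from_subspace `[0, T])].

End vector_valued_paths.

Section hilbert.
Context {R : realType} {H : normedModType R} (dot : {dot H for idfun}).
Implicit Types (a b : R) (f g : R -> H) (s : seq R) (xi : nat -> R).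

(* As in [itv_partition], the partition a = p_0 < p_1 < ... < p_n = b is
   [a :: s]; [xi i] is the tag in [p_i, p_{i+1}]. *)
Definition tagged_partition a b s xi : Prop :=
  let p := nth b (a :: s) in
  itv_partition a b s /\
  forall i, (i < size s)%N -> p i <= xi i <= p i.+1.

Definition mesh_lt a b s (delta : R) : Prop :=
  let p := nth b (a :: s) in
  forall i, (i < size s)%N -> p i.+1 - p i < delta.

Definition stieltjes_sum a b f g s xi : R :=
  let p := nth b (a :: s) in
  \sum_(0 <= i < size s) dot (f (xi i)) (g (p i.+1) - g (p i)).

(* The Riemann-Stieltjes integral of <f(r), dg(r)> over [a, b] exists and
   equals I. It always exists for f continuous and g of bounded variation. *)
Definition is_stieltjes_integral a b f g (I : R) : Prop :=
  forall eps : R, 0 < eps -> exists2 delta : R, 0 < delta &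
    forall s xi, tagged_partition a b s xi -> mesh_lt a b s delta ->
      `|stieltjes_sum a b f g s xi - I| < eps.

(* A multivalued operator is identified with its graph, a subset of H * H. *)
Definition Dom (A : set (H * H)) : set H := A.`1.

Definition monotone_op (A : set (H * H)) : Prop :=
  forall u v, A u -> A v -> 0 <= dot (u.1 - v.1) (u.2 - v.2).

Definition maximal_monotone (A : set (H * H)) : Prop :=
  monotone_op A /\ forall B, monotone_op B -> A `<=` B -> B = A.

(* In [GSP_ineq], dk(r) - z* dr is the differential of r |-> k(r) - r z*. *)
Record GSP (A : set (H * H)) (T : R) (x0 : H) (m x k : R -> H) : Prop := {
  GSP_x_continuous : {within `[0, T], continuous x} ;
  GSP_x_dom : forall t : R, 0 <= t <= T -> closure (Dom A) (x t) ;
  GSP_k_continuous : {within `[0, T], continuous k} ;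
  GSP_k_BV0 : BV0 T k ;
  GSP_eq : forall t : R, 0 <= t <= T -> x t + k t = x0 + m t ;
  GSP_ineq : forall z zs, A (z, zs) ->
    forall s t : R, 0 <= s -> s <= t -> t <= T ->
      exists2 I : R,
        is_stieltjes_integral s t (fun r => x r - z) (fun r => k r - r *: zs) I
        & 0 <= I
}.

End hilbert.

(* Main.v *)
Require Import Defs.
From mathcomp Require Import all_boot all_order all_algebra sesquilinear.
From mathcomp Require Import all_classical all_reals all_analysis.
From mathcomp Require Import ring lra.

Import Order.TTheory GRing.Theory Num.Theory.
Import numFieldNormedType.Exports.

Local Open Scope classical_set_scope.
Local Open Scope ring_scope.

(** Everything rests on two estimates for paths [x = x0 + m - k] such that
    [dk] is, up to a small error, a selection of [A x dt].

    The first one bounds [x] and the variation of [k].  As the domain of [A]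
    has interior points, Baire's theorem provides a point [u0] around which
    [A] is bounded in a weak sense ([interior_support]).  Testing the
    inequality of the problem in the direction of each increment of [k] gives
    [rho Var(k) <= int <x - u0, dk> + O(1)] ([variation_bound]).  On an interval
    where [m] oscillates by at most [rho / 4], the chain rule for
    [|x - u0 - (m - m(a))|^2] turns this into a bound of both [x] and [Var(k)]
    in terms of the initial value ([cell_bound]).  Finitely many such
    intervals suffice, and their number depends on the modulus of continuity of
    [m] only; this is where equicontinuity enters ([apriori]).

    The second one compares two paths.  Formally
    [int <x - X, dk - dK> >= 0] by monotonicity, and the chain rule for
    [|x - X - (m - m')|^2] yields
    [|x - X - (m - m')|^2 <= |x0 - x0'|^2 + 2 |m - m'| (Var(k) + Var(K))].
    For two solutions the monotonicity of the integral is not immediate, since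
    the inequality of the problem can only be tested at points of the graph of
    [A].  It is immediate when the second path is an Euler approximation,
    because then the slope of [K] is a value of [A] at a point close to the path
    ([comparison]).  Two solutions are compared through Euler approximations
    of one of them ([stability]), which also gives uniqueness.

    Euler approximations with arbitrarily small error exist for data in the
    domain of [A]: the implicit Euler scheme applies, with the resolvents of [A]
    (Minty's theorem, [resolvent]) and a piecewise linear interpolation of [m]
    ([euler_exists]).  By [comparison], approximations whose errors tend to
    [0] converge uniformly, and their variations are bounded by [apriori]; a
    uniform limit of approximate solutions of bounded variation is a solution
    ([aGSP_limit]), whence [existence].

    Integrals of the form [int <f, dg>] are taken along the filter of fine
    tagged partitions ([RS]).  For [f] uniformly continuous and [g] of bounded
    variation they exist, are bilinear and additive over intervals, and agree
    with [is_stieltjes_integral]. *)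

(** * Hilbert spaces, resolvents and local boundedness *)

Section hilbert_space.
Context {R : realType} {H : completeNormedModType R} (dot : {dot H for idfun})
  (norm_dot : forall u : H, `|u| ^+ 2 = dot u u).
Implicit Types (A : set (H * H)).

Lemma dotDl (u v w : H) : dot (u + v) w = dot u w + dot v w :> R.
Proof. exact: linearDl. Qed.

Lemma dotDr (u v w : H) : dot w (u + v) = dot w u + dot w v :> R.
Proof. exact: linearDr. Qed.

Lemma dotNl (u w : H) : dot (- u) w = - dot u w :> R.
Proof. exact: linearNl. Qed.

Lemma dotNr (u w : H) : dot w (- u) = - dot w u :> R.
Proof. exact: linearNr. Qed.

Lemma dotZl c (u w : H) : dot (c *: u) w = c * dot u w :> R.
Proof. exact: linearZl_LR. Qed.

Lemma dotZr c (u w : H) : dot w (c *: u) = c * dot w u :> R.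
Proof. exact: linearZr_LR. Qed.

Lemma dot0l w : dot 0 w = 0 :> R.
Proof. exact: linear0l. Qed.

Lemma dot0r w : dot w 0 = 0 :> R.
Proof. exact: linear0r. Qed.

Lemma dot_sumr w n (F : nat -> H) :
  dot w (\sum_(0 <= i < n) F i) = \sum_(0 <= i < n) dot w (F i).
Proof. exact: linear_sumr. Qed.

Definition dotE := (dotDl, dotDr, dotNl, dotNr, dotZl, dotZr, dot0l, dot0r).

Lemma dotC u w : dot u w = dot w u :> R.
Proof. by rewrite hermC /= expr0 mul1r. Qed.

Lemma dot_ge0 u : 0 <= dot u u.
Proof. by rewrite -norm_dot sqr_ge0. Qed.

(** Identities between vectors become scalar ones, which [ring] decides. *)
Lemma dot_ext (u v : H) : (forall d, dot u d = dot v d) -> u = v.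
Proof.
move=> uv; apply/subr0_eq/eqP; rewrite -normr_eq0 -sqrf_eq0 norm_dot.
by rewrite dotDl dotNl uv subrr.
Qed.

Lemma dot_le_norm u v : dot u v <= `|u| * `|v|.
Proof.
have [->|u0] := eqVneq u 0; first by rewrite dot0l normr0 mul0r.
have [->|v0] := eqVneq v 0; first by rewrite dot0r normr0 mulr0.
have a0 : 0 < `|u| by rewrite normr_gt0.
have b0 : 0 < `|v| by rewrite normr_gt0.
have := dot_ge0 (`|v| *: u - `|u| *: v).
rewrite !dotE -!norm_dot (dotC v u).
set a := `|u|; set b := `|v|; set c := dot u v => h.
have ab : 0 < a * b by rewrite mulr_gt0.
have : 0 <= 2 * (a * b) * (a * b - c) by apply: le_trans h _; rewrite le_eqVlt; apply/orP; left; apply/eqP; ring.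
by rewrite pmulr_rge0 ?subr_ge0// mulr_gt0.
Qed.

Lemma normr_dot_le u v : `|dot u v| <= `|u| * `|v|.
Proof.
rewrite ler_norml dot_le_norm andbT lerNl -dotNl.
by rewrite (le_trans (dot_le_norm _ _))// normrN.
Qed.

Lemma sqr_normD_le (u v : H) : `|u + v| ^+ 2 <= 2 * `|u| ^+ 2 + 2 * `|v| ^+ 2.
Proof.
have := dot_ge0 (u - v); rewrite !norm_dot !dotE (dotC v u); lra.
Qed.

Definition related A (p : H * H) :=
  forall w, A w -> 0 <= dot (p.1 - w.1) (p.2 - w.2).

(** Adding one related point to the graph keeps it monotone, so that the
    graph was not maximal unless it contained the point already. *)
Lemma maximal_related A : maximal_monotone dot A ->
  forall p, related A p -> A p.
Proof.
move=> [Amon Amax] p Ap.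
have -> : A = A `|` [set p].
  symmetry; apply: Amax; last by move=> u; left.
  move=> u v [Au|->] [Av|->]; [exact: Amon|  |exact: Ap|].
  - have := Ap _ Au; rewrite !dotE; lra.
  - by rewrite !subrr dot0l.
by right.
Qed.

(** Energy estimates bound squared distances by a sum of two errors, one for
    each index. *)
Lemma cvgn_sqr_cauchy (u : H ^nat) (e : R ^nat) :
  (forall n m, `|u n - u m| ^+ 2 <= e n + e m) -> e @ \oo --> 0 -> cvgn u.
Proof.
move=> ue e0; apply/cauchy_cvgP/cauchyP => d d0.
have : \forall n \near \oo, e n < d ^+ 2 / 2.
  by apply: (cvgr_lt 0) => //; rewrite divr_gt0 ?exprn_gt0.
move=> [N _ hN]; exists (u N); exists N => // n /= Nn.
rewrite -ball_normE /= -(ltr_pXn2r (n := 2)) ?nnegrE ?(ltW d0)//.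
apply: le_lt_trans (ue _ _) _; have := hN n Nn; have := hN N (leqnn N).
by rewrite /=; lra.
Qed.

Lemma harmonic_cvg : (fun n => n.+1%:R^-1 : R) @ \oo --> (0 : R).
Proof. exact: cvg_harmonic. Qed.

(** Minty's theorem at [0], after Simons and Zalinescu.  The epigraph of
    the Fitzpatrick function
    [F (x, y) = sup_((u, v) in A) (<x, v> + <u, y> - <u, v>)] is described by
    [adm], which spares its infinite values.  By maximality
    [F (x, y) >= <x, y>], whence the strongly convex function
    [F (x, y) + (|x|^2 + |y|^2) / 2] is nonnegative.  It attains its infimum
    because minimising sequences are Cauchy (parallelogram identity), and the
    optimality condition at a minimiser [(x, y)] says that [(- y, - x)] is
    related to [A] and that [|x + y|^2 <= 0]. *)
Lemma resolvent0 A : (forall p, related A p -> A p) -> monotone_op dot A ->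
  exists x, A (x, - x).
Proof.
move=> Amax Amon.
pose adm x y c := forall u v, A (u, v) -> dot x v + dot u y - dot u v <= c :> R.
pose val x y c : R := c + (dot x x + dot y y) / 2.
(* otherwise [(x, y)] would be related to [A], hence belong to it *)
have adm_ge x y c : adm x y c -> dot x y <= c.
  move=> xyc; rewrite leNgt; apply/negP => cxy.
  suff /xyc /= : A (x, y) by lra.
  apply: Amax => -[u v] Auv /=; have := xyc u v Auv; rewrite !dotE; lra.
have admA u v : A (u, v) -> adm u v (dot u v).
  move=> Auv u' v' Auv'; have := Amon _ _ Auv Auv'; rewrite /= !dotE; lra.
pose G := [set r : R | exists x y c, adm x y c /\ r = val x y c].
have hG : has_inf G.
  split; last first.
    exists 0 => _ [x [y [c [/adm_ge h ->]]]].
    have := dot_ge0 (x + y); rewrite /val !dotE (dotC y x); lra.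
  have [[u v] Auv] : exists w, A w.
    apply: contrapT => A0; apply: (A0); exists (0, 0); apply: Amax => w Aw.
    by case: A0; exists w.
  by exists (val u v (dot u v)), u, v, (dot u v); split=> //; exact: admA.
pose I := inf G.
have I_le x y c : adm x y c -> I <= val x y c.
  by move=> h; apply: ge_inf; [exact: hG.2|exists x, y, c].
have /choice[p hp] n : exists p : H * H * R,
    adm p.1.1 p.1.2 p.2 /\ val p.1.1 p.1.2 p.2 < I + n.+1%:R^-1.
  have e0 : 0 < n.+1%:R^-1 :> R by rewrite invr_gt0.
  have [r [x [y [c [h ->]]]] ?] := inf_adherent e0 hG.
  by exists (x, y, c).
(* the value at the midpoint is at least the infimum *)
have mid n m : dot ((p n).1.1 - (p m).1.1) ((p n).1.1 - (p m).1.1) +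
    dot ((p n).1.2 - (p m).1.2) ((p n).1.2 - (p m).1.2) <=
    4 * n.+1%:R^-1 + 4 * m.+1%:R^-1.
  have [+ vn] := hp n; have [+ vm] := hp m.
  case: (p n) (p m) vn vm => [[x y] c] [[x' y'] c'] /= vn vm ad' ad.
  have /I_le : adm (2^-1 *: (x + x')) (2^-1 *: (y + y')) ((c + c') / 2).
    move=> u v Auv; have := ad u v Auv; have := ad' u v Auv; rewrite !dotE /=; lra.
  move: vn vm; rewrite /val !dotE (dotC x' x) (dotC y' y).
  move: (n.+1%:R^-1) (m.+1%:R^-1) => a b. lra.
have e0 : (fun n => 4 * n.+1%:R^-1 : R) @ \oo --> (0 : R).
  by rewrite -[X in _ --> X](mulr0 4); apply: cvgMr harmonic_cvg.
have /cvg_ex[x px] : cvgn (fun n => (p n).1.1).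
  apply: cvgn_sqr_cauchy e0 => n m; rewrite norm_dot.
  by apply: le_trans (mid n m); rewrite lerDl dot_ge0.
have /cvg_ex[y py] : cvgn (fun n => (p n).1.2).
  apply: cvgn_sqr_cauchy e0 => n m; rewrite norm_dot.
  by apply: le_trans (mid n m); rewrite lerDr dot_ge0.
(* completing the squares turns the inequalities that define [adm] into
   inequalities between norms, which pass to the limit *)
have admxy : adm x y (I - (dot x x + dot y y) / 2).
  move=> u v Auv.
  suff : `|x + v| ^+ 2 + `|y + u| ^+ 2 <=
      2 * (I + dot u v + 0) + dot u u + dot v v.
    by rewrite !norm_dot !dotE (dotC u y) (dotC v x); lra.
  have cl : (fun n => `|(p n).1.1 + v| ^+ 2 + `|(p n).1.2 + u| ^+ 2) @ \oo -->
      `|x + v| ^+ 2 + `|y + u| ^+ 2.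
    by apply: cvgD; apply: cvgM; apply: cvg_norm; apply: cvgD => //; exact: cvg_cst.
  have cr : (fun n => 2 * (I + dot u v + n.+1%:R^-1) + dot u u + dot v v) @ \oo -->
      2 * (I + dot u v + 0) + dot u u + dot v v.
    do 2!(apply: cvgD; last exact: cvg_cst).
    by apply: cvgMr; apply: cvgD; [exact: cvg_cst|exact: harmonic_cvg].
  apply: (ler_cvg_to cl cr); near=> n.
  have [adn] := hp n; have := adn u v Auv.
  rewrite /val !norm_dot !dotE (dotC u (p n).1.2) (dotC v (p n).1.1).
  move: (n.+1%:R^-1) => e; lra.
set c0 := I - _ in admxy.
(* first variation along the segment from the minimiser to [(x', y')] *)
have opt x' y' d : adm x' y' d ->
    0 <= d - c0 + dot x (x' - x) + dot y (y' - y).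
  move=> ad; set a := (X in 0 <= X).
  pose q := dot (x' - x) (x' - x) + dot (y' - y) (y' - y).
  have q0 : 0 <= q by rewrite addr_ge0 ?dot_ge0.
  have key t : 0 < t -> t <= 1 -> 0 <= a + t * q.
    move=> t0 t1.
    have /I_le : adm (x + t *: (x' - x)) (y + t *: (y' - y)) (c0 + t * (d - c0)).
      move=> u v Auv; have h1 := admxy u v Auv; have h2 := ad u v Auv.
      have h3 : (1 - t) * (dot x v + dot u y - dot u v) <= (1 - t) * c0.
        by rewrite ler_wpM2l// subr_ge0.
      have h4 : t * (dot x' v + dot u y' - dot u v) <= t * d.
        by rewrite ler_wpM2l// ltW.
      rewrite !dotE; move: h3 h4; lra.
    rewrite /val /c0 !dotE (dotC x' x) (dotC y' y) => h.
    have : 0 <= t * (a + t * q).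
      have t2q : 0 <= t * t * q by rewrite !mulr_ge0// ltW.
      move: h t2q; rewrite /a /q /c0 !dotE (dotC x' x) (dotC y' y); lra.
    by rewrite pmulr_rge0.
  rewrite leNgt; apply/negP => a0.
  have q1 : 0 < q + 1 by lra.
  pose t := Num.min 1 (- a / (q + 1) / 2).
  have t0 : 0 < t by rewrite lt_min ltr01 !divr_gt0// oppr_gt0.
  have t1 : t <= 1 by rewrite ge_min lexx.
  have tq : t * (q + 1) <= - a / 2.
    have : t * (q + 1) <= - a / (q + 1) / 2 * (q + 1).
      by rewrite ler_wpM2r ?ge_min ?lexx ?orbT// ltW.
    by move/le_trans; apply; rewrite mulrAC divfK// gt_eqF.
  have := key t t0 t1; lra.
have xyc := adm_ge _ _ _ admxy.
have Amin : A (- y, - x).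
  apply: Amax => -[u v] Auv /=; have := opt _ _ _ (admA u v Auv).
  have := dot_ge0 (x + y).
  rewrite !dotE (dotC y x) (dotC u x) (dotC y v); lra.
have := opt _ _ _ (admA _ _ Amin); rewrite !dotE (dotC y x) => h.
have : dot (x + y) (x + y) <= 0 by rewrite !dotE (dotC y x); lra.
rewrite -norm_dot => h2.
have : `|x + y| ^+ 2 = 0 by apply/le_anti; rewrite h2 sqr_ge0.
move/eqP; rewrite sqrf_eq0 normr_eq0 addr_eq0 => /eqP yx.
by exists x; move: Amin; rewrite -yx.
Unshelve. all: by end_near. Qed.

(** This is [resolvent0] for the operator [h A - y], which is maximal monotone
    because [A] is. *)
Lemma resolvent A h y : maximal_monotone dot A -> 0 < h ->
  exists z zs, A (z, zs) /\ z + h *: zs = y.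
Proof.
move=> Amax h0.
pose B := [set p : H * H | A (p.1, h^-1 *: (p.2 + y))].
have h1 : h != 0 by rewrite gt_eqF.
have [x Bx] : exists x, B (x, - x).
  apply: resolvent0 => [p pB|u v Au Av].
    apply: (maximal_related A Amax) => w Aw /=.
    have /= := pB (w.1, h *: w.2 - y).
    rewrite /B /= subrK scalerA mulVf// scale1r; case: (w) Aw => w1 w2 /= Aw.
    move=> /(_ Aw) hp.
    have -> : h^-1 *: (p.2 + y) - w2 = h^-1 *: (p.2 - (h *: w2 - y)).
      by rewrite opprB addrA scalerBr scalerA mulVf// scale1r.
    by rewrite dotZr mulr_ge0// invr_ge0 ltW.
  have := Amax.1 _ _ Au Av => /=; rewrite -scalerBr dotZr pmulr_rge0 ?invr_gt0//.
  by rewrite opprD addrACA subrr addr0.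
exists x, (h^-1 *: (- x + y)); split => //.
by rewrite scalerA divff// scale1r addNKr.
Qed.

(** Local boundedness of a monotone operator inside its domain, in the weak
    form that the energy estimates use.  By Baire's theorem one of the sets of
    points [z] having some [zs] in [A z] with [|zs| <= n] is dense in a ball,
    and [z] is picked near the point of the ball that is extreme in the
    direction [d]. *)
Lemma interior_support A : (interior (Dom A)) !=set0 ->
  exists (u0 : H) (rho mu : R), [/\ 0 < rho, 0 <= mu &
    forall d : H, exists z zs,
      [/\ A (z, zs), rho * `|d| <= dot (z - u0) d, `|z - u0| <= 3 * rho
         & `|zs| <= mu]].
Proof.
move=> [a aA].
pose E n := [set z : H | exists2 zs, A (z, zs) & `|zs| <= n%:R].
have [n nd] : exists n, ~ dense (~` closure (E n)).
  apply: contrapT => h.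
  have /Baire : forall n, open (~` closure (E n)) /\ dense (~` closure (E n)).
    move=> n; split; first exact/closed_openC/closed_closure.
    by apply: contrapT => nd; apply: h; exists n.
  have o : open (interior (Dom A)) by exact: open_interior.
  move=> /(_ _ _ o)[]; first by exists a.
  move=> z [/interior_subset [zs Az] zE].
  have [n zn] : exists n : nat, `|zs| <= n%:R.
    by exists (Num.truncn `|zs|).+1; rewrite ltW// truncnS_gt.
  by apply: (zE n I); apply: subset_closure; exists zs.
have [W [u0 Wu0] [oW WE]] : exists2 W : set H, W !=set0 & open W /\ W `<=` closure (E n).
  apply: contrapT => h; apply: nd => W W0 oW.
  apply: contrapT => h2; apply: h; exists W => //; split => // z Wz.
  by apply: contrapT => nz; apply: h2; exists z.
have [r /= r0 rW] : exists2 r : R, 0 < r & ball u0 r `<=` W.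
  by have /nbhs_ballP[r /= r0 ?] := open_nbhs_nbhs (conj oW Wu0); exists r.
pose rho := r / 4.
have rho0 : 0 < rho by rewrite divr_gt0.
exists u0, rho, n%:R; split => // d.
pose e := if d == 0 then 0 else `|d|^-1 *: d.
have ed : dot e d = `|d|.
  rewrite /e; case: eqVneq => [->|d0]; first by rewrite dot0l normr0.
  by rewrite dotZl -norm_dot expr2 mulKf// normr_eq0.
have e1 : `|e| <= 1.
  rewrite /e; case: eqVneq => [_|d0]; first by rewrite normr0.
  by rewrite normrZ normfV normr_id mulVf// normr_eq0.
have : closure (E n) (u0 + (2 * rho) *: e).
  apply: WE; apply: rW; rewrite -ball_normE /= opprD addNKr normrN normrZ gtr0_norm ?mulr_gt0//.
  apply: (@le_lt_trans _ _ (2 * rho)); last by rewrite /rho; lra.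
  by rewrite ler_piMr// mulr_ge0// ltW.
move=> /(_ (ball (u0 + (2 * rho) *: e) rho) (nbhsx_ballx _ _ rho0)).
move=> [z [[zs Az zsn]]]; rewrite -ball_normE /= => zb.
set q := u0 + _ - z in zb.
have -> : rho * `|d| = (2 * rho) * `|d| - rho * `|d| by ring.
have zE : z - u0 = (2 * rho) *: e - q 
  by apply: dot_ext => ?; rewrite /q !dotE; ring.
exists z, zs; split => //.
- rewrite zE dotDl dotZl ed dotNl lerB//.
  by rewrite (le_trans (dot_le_norm _ _))// ler_wpM2r// ltW.
- rewrite zE (le_trans (ler_normB _ _))//.
  have : `|(2 * rho) *: e| <= 2 * rho.
    by rewrite normrZ gtr0_norm ?mulr_gt0// ler_piMr// mulr_ge0// ltW.
  lra.
Qed.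

End hilbert_space.

(** * Riemann-Stieltjes integrals *)

Section stieltjes.
Context {R : realType} {H : completeNormedModType R} (dot : {dot H for idfun})
  (norm_dot : forall u : H, `|u| ^+ 2 = dot u u).
Implicit Types (a b c : R) (f g : R -> H) (w : R -> R) (n : nat) (p xi : nat -> R).

Definition ucont a b f := forall e, 0 < e -> exists2 d, 0 < d &
  forall s t, a <= s <= b -> a <= t <= b -> `|s - t| < d -> `|f s - f t| < e.

(** Bounded variation, witnessed by a scalar function [w] whose increments
    dominate those of [g]: unlike the total variation such a control is at
    once additive in [g] and over intervals. *)
Definition ctrl a b g w := forall s t, a <= s -> s <= t -> t <= b ->
  `|g t - g s| <= w t - w s.

Definition is_partition a b n p :=
  [/\ p 0%N = a, p n = b & forall i, (i < n)%N -> p i <= p i.+1].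

Definition is_tagged a b (q : nat * (nat -> R) * (nat -> R)) :=
  [/\ q.1.2 0%N = a, q.1.2 q.1.1 = b
    & forall i, (i < q.1.1)%N -> q.1.2 i <= q.2 i <= q.1.2 i.+1].

Definition finer (d : R) (q : nat * (nat -> R) * (nat -> R)) :=
  forall i, (i < q.1.1)%N -> q.1.2 i.+1 - q.1.2 i < d.

Definition rsum f g (q : nat * (nat -> R) * (nat -> R)) : R :=
  \sum_(0 <= i < q.1.1) dot (f (q.2 i)) (g (q.1.2 i.+1) - g (q.1.2 i)).

(** The integral is a limit as the mesh tends to [0].  Partitions may repeat a
    point, so that a partition clamped to a subinterval is again one. *)
Definition fine_partitions a b : set_system (nat * (nat -> R) * (nat -> R)) :=
  filter_from [set d | 0 < d] (fun d => [set q | is_tagged a b q /\ finer d q]).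

Definition RS a b f g : R := lim (rsum f g @ fine_partitions a b).

Lemma partition_mono a b n p i j : is_partition a b n p ->
  (i <= j <= n)%N -> p i <= p j.
Proof.
move=> [_ _ pS] /andP[+ jn]; elim: j jn => [_|j ih jn]; first by rewrite leqn0 => /eqP->.
rewrite leq_eqVlt => /predU1P[->//|]; rewrite ltnS => ij.
by apply: le_trans (ih (ltnW jn) ij) _; exact: pS.
Qed.

Lemma partition_in a b n p i : is_partition a b n p -> (i <= n)%N -> a <= p i <= b.
Proof.
move=> P ni; have [pa pb _] := P.
by rewrite -{1}pa -pb (partition_mono _ _ _ _ _ _ P)//= (partition_mono _ _ _ _ _ _ P)// ni leqnn.
Qed.

Lemma tagged_partition a b q : is_tagged a b q -> is_partition a b q.1.1 q.1.2.
Proof.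
by move=> [qa qb qx]; split => // i /qx /andP[]; exact: le_trans.
Qed.

Lemma tag_in a b q i : is_tagged a b q -> (i < q.1.1)%N -> a <= q.2 i <= b.
Proof.
move=> Q iq; have P := tagged_partition _ _ _ Q.
have /andP[h1 h2] : q.1.2 i <= q.2 i <= q.1.2 i.+1 by case: Q => _ _; exact.
have /andP[h3 _] := partition_in _ _ _ _ _ P (ltnW iq).
have /andP[_ h4] := partition_in _ _ _ _ _ P iq.
by rewrite (le_trans h3 h1) (le_trans h2 h4).
Qed.

Definition grid a b n (i : nat) : R := a + i%:R * ((b - a) / n%:R).

Lemma grid0 a b n : grid a b n 0 = a.
Proof. by rewrite /grid mul0r addr0. Qed.

Lemma gridn a b n : (0 < n)%N -> grid a b n n = b.
Proof.
by move=> n0; rewrite /grid mulrC divfK ?pnatr_eq0 -?lt0n// addrC subrK.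
Qed.

Lemma gridS a b n i : grid a b n i.+1 = grid a b n i + (b - a) / n%:R.
Proof. by rewrite /grid -natr1 mulrDl mul1r addrA. Qed.

Lemma grid_partition a b n : a <= b -> (0 < n)%N -> is_partition a b n (grid a b n).
Proof.
move=> ab n0; split; [exact: grid0|exact: gridn|move=> i _].
by rewrite gridS lerDl divr_ge0// subr_ge0.
Qed.

Lemma small_step a b d : 0 < d -> exists2 n, (0 < n)%N & (b - a) / n%:R < d.
Proof.
move=> d0; exists (Num.truncn (`|b - a| / d)).+1 => //.
rewrite ltr_pdivrMr// mulrC -ltr_pdivrMr//.
apply: le_lt_trans (truncnS_gt _).
by rewrite ler_pM2r ?invr_gt0// ler_norm.
Qed.

Lemma grid_tagged a b d : a <= b -> 0 < d ->
  exists2 n, (0 < n)%N & is_tagged a b (n, grid a b n, grid a b n) /\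
    finer d (n, grid a b n, grid a b n).
Proof.
move=> ab d0; have [n n0 nd] := small_step a b _ d0.
have [? ? gS] := grid_partition _ _ _ ab n0.
exists n => //; split; first by split => // i /= ni; rewrite lexx gS.
by move=> i /= _; rewrite gridS addrAC subrr add0r.
Qed.

Lemma fine_partitions_filter a b : a <= b -> ProperFilter (fine_partitions a b).
Proof.
move=> ab; apply: filter_from_proper => /=; last first.
  move=> d /= d0; have [n _ ?] := grid_tagged _ _ _ ab d0.
  by exists (n, grid a b n, grid a b n).
apply: filter_from_filter; first by exists 1 => /=.
move=> d d' /= d0 d'0; exists (Num.min d d'); first by rewrite lt_min d0.
move=> q [Q qd]; split; split => // i /qd; rewrite lt_min => /andP[] //.
Qed.

Lemma near_partitions a b (P : set (nat * (nat -> R) * (nat -> R))) (d : R) :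
  0 < d -> (forall q, is_tagged a b q -> finer d q -> P q) -> \forall q \near fine_partitions a b, P q.
Proof. by move=> d0 h; exists d => // q [] /=; exact: h. Qed.

(** The increment of [g] over the intersection of [[x, x']] and [[y, y']], which
    is [0] if these intervals do not meet. *)
Definition meet_incr {V : zmodType} (g : R -> V) x x' y y' : V :=
  g (Num.min x' y') - g (Num.min x' y) - (g (Num.min x y') - g (Num.min x y)).

Lemma meet_incrE {V : zmodType} (g : R -> V) x x' y y' : x <= x' -> y <= y' ->
  meet_incr g x x' y y' = if Num.max x y <= Num.min x' y' then
     g (Num.min x' y') - g (Num.max x y) else 0.
Proof.
move=> xx' yy'; rewrite /meet_incr; case: ifPn => [|].
  rewrite ge_max !le_min => /andP[/andP[_ xy'] /andP[yx' _]].
  rewrite (min_idPr yx') (min_idPl xy').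
  have [xy|yx] := leP x y; first by rewrite subrr subr0.
  by rewrite opprB addrA subrK.
rewrite -ltNge lt_max !gt_min => h.
have [x'y|yx'] := ltP x' y.
  have xy := le_lt_trans xx' x'y.
  rewrite (min_idPl (ltW (lt_le_trans x'y yy'))).
  by rewrite (min_idPl (ltW xy)) (min_idPl (ltW (lt_le_trans xy yy'))) !subrr.
have y'x : y' < x.
  by move: h; rewrite (ltNge x' x) (ltNge x' y) (ltNge y' y) xx' yx' yy' /= orbF.
rewrite (min_idPr (ltW y'x)) (min_idPr (ltW (le_lt_trans yy' y'x))).
by rewrite (min_idPr (ltW (lt_le_trans y'x xx'))) subrr.
Qed.

Lemma sum_meet_incr {V : zmodType} (g : R -> V) a b n p x x' : is_partition a b n p ->
  a <= x -> x <= x' -> x' <= b ->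
  \sum_(0 <= j < n) meet_incr g x x' (p j) (p j.+1) = g x' - g x.
Proof.
move=> [pa pb _] ax xx' x'b; rewrite /meet_incr sumrB.
rewrite !telescope_sumr// pa pb (min_idPl x'b) (min_idPl (le_trans xx' x'b)).
rewrite (min_idPr ax) (min_idPr (le_trans ax xx')).
by rewrite opprB addrA subrK.
Qed.

Lemma meet_incrC {V : zmodType} (g : R -> V) x x' y y' :
  meet_incr g x x' y y' = meet_incr g y y' x x'.
Proof.
by rewrite /meet_incr !opprB ![Num.min y _]minC ![Num.min y' _]minC addrACA [in RHS]addrACA (addrC (- _)).
Qed.

Lemma ctrl_mono a b g w s t : ctrl a b g w -> a <= s -> s <= t -> t <= b ->
  w s <= w t.
Proof. by move=> gw ? ? ?; rewrite -subr_ge0 (le_trans _ (gw s t _ _ _)). Qed.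

(** Both sums are rewritten over the cells of the common refinement, each of
    which is the intersection of a cell of [q] and a cell of [q']. *)
Lemma rsum_close a b f g w (e d : R) q q' : ctrl a b g w ->
  (forall s t, a <= s <= b -> a <= t <= b -> `|s - t| < d + d -> `|f s - f t| <= e) ->
  is_tagged a b q -> finer d q -> is_tagged a b q' -> finer d q' ->
  `|rsum f g q - rsum f g q'| <= e * (w b - w a).
Proof.
move=> gw fe Q qd Q' q'd.
have P := tagged_partition _ _ _ Q; have P' := tagged_partition _ _ _ Q'.
case: q q' Q Q' qd q'd P P' => [[n p] xi] [[n' p'] xi'] Q Q' /= qd q'd P P'.
have [pa pb pS] := P; have [p'a p'b p'S] := P'.
have inP i : (i < n)%N -> [/\ a <= p i, p i <= p i.+1 & p i.+1 <= b].
  move=> ni; have /andP[? _] := partition_in _ _ _ _ _ P (ltnW ni).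
  by have /andP[_ ?] := partition_in _ _ _ _ _ P ni; split => //; exact: pS.
have inP' i : (i < n')%N -> [/\ a <= p' i, p' i <= p' i.+1 & p' i.+1 <= b].
  move=> ni; have /andP[? _] := partition_in _ _ _ _ _ P' (ltnW ni).
  by have /andP[_ ?] := partition_in _ _ _ _ _ P' ni; split => //; exact: p'S.
pose E (V : zmodType) (h : R -> V) i j := meet_incr h (p i) (p i.+1) (p' j) (p' j.+1).
have sumE : rsum f g (n, p, xi) =
    \sum_(0 <= i < n) \sum_(0 <= j < n') dot (f (xi i)) (E _ g i j).
  apply: eq_big_nat => i /= ni; have [? ? ?] := inP i ni.
  by rewrite -(sum_meet_incr g _ _ _ _ _ _ P')// dot_sumr.
have sumE' : rsum f g (n', p', xi') =
    \sum_(0 <= i < n) \sum_(0 <= j < n') dot (f (xi' j)) (E _ g i j).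
  rewrite exchange_big /=; apply: eq_big_nat => i /= ni; have [? ? ?] := inP' i ni.
  rewrite -(sum_meet_incr g _ _ _ _ _ _ P)// dot_sumr.
  by apply: eq_bigr => j _; rewrite meet_incrC.
have sumw : \sum_(0 <= i < n) \sum_(0 <= j < n') E _ w i j = w b - w a.
  rewrite -pa -pb -(telescope_sumr (fun i => w (p i)) (leq0n n)); apply: eq_big_nat => i /= ni.
  by have [? ? ?] := inP i ni; rewrite (sum_meet_incr w _ _ _ _ _ _ P').
rewrite sumE sumE' -sumrB -sumw mulr_sumr (le_trans (ler_norm_sum _ _ _))//.
apply: ler_sum_nat => i /= ni.
rewrite -sumrB mulr_sumr (le_trans (ler_norm_sum _ _ _))//.
apply: ler_sum_nat => j /= nj.
have [ai ii bi] := inP i ni; have [aj jj bj] := inP' j nj.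
(* disjoint cells contribute nothing, and the tags of two cells that meet are
   close *)
rewrite /E !meet_incrE//; case: ifP => [|_]; last first.
  by rewrite !dot0r subrr normr0 mulr0.
move=> h; have := h; rewrite ge_max !le_min => /andP[/andP[_ h1] /andP[h2 _]].
rewrite -dotNl -dotDl (le_trans (normr_dot_le _ norm_dot _ _))// ler_pM//.
  apply: fe; [exact: (tag_in _ _ _ _ Q)|exact: (tag_in _ _ _ _ Q')|].
  have /andP[h3 h4] : p i <= xi i <= p i.+1 by case: Q => _ _; exact.
  have /andP[h5 h6] : p' j <= xi' j <= p' j.+1 by case: Q' => _ _; exact.
  have := qd i ni; have := q'd j nj; rewrite /= => h7 h8.
  by rewrite ltr_norml; apply/andP; split; lra.
by apply: gw => //; rewrite ?le_max ?ai// ge_min bi.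
Qed.

Lemma rsum_cauchy a b f g w (e : R) : a <= b -> ctrl a b g w -> 0 < e ->
  ucont a b f -> exists2 d, 0 < d & forall q q',
  is_tagged a b q -> finer d q -> is_tagged a b q' -> finer d q' ->
  `|rsum f g q - rsum f g q'| < e.
Proof.
move=> ab gw e0 fc.
have w0 : 0 <= w b - w a by rewrite subr_ge0 (ctrl_mono _ _ _ _ _ _ gw).
have w1 : 0 < w b - w a + 1 by lra.
have e'0 : 0 < e / (w b - w a + 1) by rewrite divr_gt0.
have [d d0 fd] := fc _ e'0.
exists (d / 2); first by rewrite divr_gt0.
move=> q q' Q qd Q' q'd.
apply: (@le_lt_trans _ _ (e / (w b - w a + 1) * (w b - w a))).
  apply: (rsum_close a b f g w _ (d / 2)) => // s t sab tab st.
  by apply/ltW/fd => //; move: st; lra.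
by rewrite mulrAC ltr_pdivrMr// ltr_pM2l// ltrDl.
Qed.

Definition rsable a b f g := ucont a b f /\ exists w, ctrl a b g w.

Lemma RS_cvg a b f g : a <= b -> rsable a b f g ->
  rsum f g @ fine_partitions a b --> RS a b f g.
Proof.
move=> ab [fc [w gw]]; have FF := fine_partitions_filter _ _ ab.
suff : cvg (rsum f g @ fine_partitions a b) by [].
apply/cauchy_cvgP/cauchyP => e e0.
have [d d0 h] := rsum_cauchy _ _ _ _ _ _ ab gw e0 fc.
have [n _ [Q qd]] := grid_tagged _ _ _ ab d0.
exists (rsum f g (n, grid a b n, grid a b n)).
apply: (near_partitions _ _ _ d) => // q Q' q'd.
by rewrite -ball_normE /=; exact: h.
Qed.

Lemma RS_unique a b f g (l : R) : a <= b ->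
  rsum f g @ fine_partitions a b --> l -> RS a b f g = l.
Proof.
move=> ab h; have FF := fine_partitions_filter _ _ ab.
by apply: cvg_lim.
Qed.

End stieltjes.

Section stieltjes_calculus.
Context {R : realType} {H : completeNormedModType R} (dot : {dot H for idfun})
  (norm_dot : forall u : H, `|u| ^+ 2 = dot u u).
Implicit Types (a b c : R) (f g : R -> H) (w : R -> R) (n : nat) (p xi : nat -> R).

Lemma ucontD a b f f' : ucont a b f -> ucont a b f' ->
  ucont a b (fun r => f r + f' r).
Proof.
move=> fc f'c e e0; have e2 : 0 < e / 2 by rewrite divr_gt0.
have [d d0 h] := fc _ e2; have [d' d'0 h'] := f'c _ e2.
exists (Num.min d d'); first by rewrite lt_min d0.
move=> s t sab tab; rewrite lt_min => /andP[sd sd'].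
have -> : f s + f' s - (f t + f' t) = (f s - f t) + (f' s - f' t).
  by rewrite opprD addrACA.
by rewrite (le_lt_trans (ler_normD _ _))//; have := h s t sab tab sd; have := h' s t sab tab sd'; lra.
Qed.

Lemma ucontN a b f : ucont a b f -> ucont a b (fun r => - f r).
Proof.
move=> fc e e0; have [d d0 h] := fc _ e0; exists d => // s t sab tab sd.
by rewrite -opprD normrN; exact: h.
Qed.

Lemma ucontB a b f f' : ucont a b f -> ucont a b f' ->
  ucont a b (fun r => f r - f' r).
Proof. by move=> fc f'c; apply: ucontD => //; exact: ucontN. Qed.

Lemma ucont_cst a b (z : H) : ucont a b (fun=> z).
Proof. by move=> e e0; exists 1 => // *; rewrite subrr normr0. Qed.

Lemma ucontW a b a' b' f : a <= a' -> b' <= b -> ucont a b f -> ucont a' b' f.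
Proof.
move=> aa bb fc e e0; have [d d0 h] := fc _ e0; exists d => //.
move=> s t /andP[? ?] /andP[? ?]; apply: h; apply/andP; split.
- exact: le_trans aa _.
- exact: le_trans bb.
- exact: le_trans aa _.
- exact: le_trans bb.
Qed.

Lemma ctrlD a b g g' w w' : ctrl a b g w -> ctrl a b g' w' ->
  ctrl a b (fun r => g r + g' r) (fun r => w r + w' r).
Proof.
move=> gw gw' s t as_ st tb.
have -> : g t + g' t - (g s + g' s) = (g t - g s) + (g' t - g' s).
  by rewrite opprD addrACA.
rewrite (le_trans (ler_normD _ _))//.
by have := gw s t as_ st tb; have := gw' s t as_ st tb; lra.
Qed.

Lemma ctrlN a b g w : ctrl a b g w -> ctrl a b (fun r => - g r) w.
Proof. by move=> gw s t as_ st tb; rewrite -opprD normrN; exact: gw. Qed.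

Lemma ctrlB a b g g' w w' : ctrl a b g w -> ctrl a b g' w' ->
  ctrl a b (fun r => g r - g' r) (fun r => w r + w' r).
Proof. by move=> gw gw'; apply: ctrlD => //; exact: ctrlN. Qed.

Lemma ctrl_lin a b (z : H) : ctrl a b (fun r => r *: z) (fun r => r * `|z|).
Proof.
by move=> s t _ st _; rewrite -scalerBl normrZ ger0_norm ?subr_ge0// mulrBl.
Qed.

Lemma ctrlW a b a' b' g w : a <= a' -> b' <= b -> ctrl a b g w -> ctrl a' b' g w.
Proof.
by move=> aa bb gw s t a's st tb'; apply: gw => //; [exact: le_trans aa _|exact: le_trans bb].
Qed.

Lemma rsableW a b a' b' f g : a <= a' -> b' <= b -> rsable a b f g -> rsable a' b' f g.
Proof.
move=> aa bb [fc [w gw]]; split; first exact: (ucontW a b).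
by exists w; exact: (ctrlW a b).
Qed.

Lemma RS_eps a b f g (e : R) : a <= b -> rsable a b f g -> 0 < e ->
  exists2 d, 0 < d & forall q, is_tagged a b q -> finer d q ->
    `|rsum dot f g q - RS dot a b f g| < e.
Proof.
move=> ab fg e0; have FF := fine_partitions_filter _ _ ab.
have /cvgrPdist_lt/(_ _ e0) [d /= d0 h] := RS_cvg dot norm_dot _ _ _ _ ab fg.
by exists d => // q Q qd; rewrite distrC; exact: h.
Qed.

Lemma eq_eps (x y c : R) : (forall e, 0 < e -> `|x - y| <= c * e) -> x = y.
Proof.
move=> h; apply/subr0_eq/eqP; rewrite -normr_eq0 eq_le normr_ge0 andbT.
apply/ler_addgt0Pr => e e0; rewrite add0r.
have c1 : 0 < `|c| + 1 by rewrite ltr_wpDl.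
apply: le_trans (h (e / (`|c| + 1)) _) _; first by rewrite divr_gt0.
rewrite mulrA ler_pdivrMr// mulrC ler_wpM2l//; first exact: ltW.
by rewrite (le_trans (ler_norm _))// lerDl.
Qed.

Lemma RSDl a b f f' g : a <= b -> rsable a b f g -> rsable a b f' g ->
  RS dot a b (fun r => f r + f' r) g = RS dot a b f g + RS dot a b f' g.
Proof.
move=> ab fg f'g; apply: RS_unique => //.
have FF := fine_partitions_filter _ _ ab.
rewrite (_ : rsum _ _ _ = rsum dot f g \+ rsum dot f' g).
  by apply: cvgD; exact: RS_cvg.
by apply/funext => q; rewrite /rsum /= -big_split; apply: eq_bigr => i _; rewrite dotDl.
Qed.

Lemma RSBl a b f f' g : a <= b -> rsable a b f g -> rsable a b f' g ->
  RS dot a b (fun r => f r - f' r) g = RS dot a b f g - RS dot a b f' g.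
Proof.
move=> ab fg f'g; apply: RS_unique => //.
have FF := fine_partitions_filter _ _ ab.
rewrite (_ : rsum _ _ _ = rsum dot f g \- rsum dot f' g).
  by apply: cvgB; exact: RS_cvg.
by apply/funext => q; rewrite /rsum /= -sumrB; apply: eq_bigr => i _; rewrite dotDl dotNl.
Qed.

Lemma RSBr a b f g g' : a <= b -> rsable a b f g -> rsable a b f g' ->
  RS dot a b f (fun r => g r - g' r) = RS dot a b f g - RS dot a b f g'.
Proof.
move=> ab fg f'g; apply: RS_unique => //.
have FF := fine_partitions_filter _ _ ab.
rewrite (_ : rsum _ _ _ = rsum dot f g \- rsum dot f g').
  by apply: cvgB; exact: RS_cvg.
apply/funext => q; rewrite /rsum /= -sumrB; apply: eq_bigr => i _.
by rewrite !dotE; ring.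
Qed.

Lemma RSNr a b f g : a <= b -> rsable a b f g ->
  RS dot a b f (fun r => - g r) = - RS dot a b f g.
Proof.
move=> ab fg; apply: RS_unique => //.
have FF := fine_partitions_filter _ _ ab.
rewrite (_ : rsum _ _ _ = \- rsum dot f g).
  by apply: cvgN; exact: RS_cvg.
apply/funext => q; rewrite /rsum /= -sumrN; apply: eq_bigr => i _.
by rewrite !dotE; ring.
Qed.

Lemma RS_ext a b f f' g g' : a <= b -> rsable a b f' g' ->
  (forall r, a <= r <= b -> f r = f' r) ->
  (forall s t, a <= s -> s <= t -> t <= b -> g t - g s = g' t - g' s) ->
  RS dot a b f g = RS dot a b f' g'.
Proof.
move=> ab fg ff gg; apply: RS_unique => //.
have FF := fine_partitions_filter _ _ ab.
apply: cvg_trans (RS_cvg dot norm_dot _ _ _ _ ab fg).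
apply: near_eq_cvg; apply: (near_partitions _ _ _ 1) => // q Q _.
apply: eq_big_nat => i /= iq; have P := tagged_partition _ _ _ Q.
rewrite ff ?(tag_in _ _ _ _ Q)// gg//.
- by have /andP[] := partition_in _ _ _ _ _ P (ltnW iq).
- by case: P => _ _; exact.
- by have /andP[] := partition_in _ _ _ _ _ P iq.
Qed.

Lemma rsum_bound a b f g w (M : R) q : ctrl a b g w -> is_tagged a b q ->
  (forall r, a <= r <= b -> `|f r| <= M) -> `|rsum dot f g q| <= M * (w b - w a).
Proof.
move=> gw Q fM; have P := tagged_partition _ _ _ Q; have [pa pb pS] := P.
have <- : \sum_(0 <= i < q.1.1) (w (q.1.2 i.+1) - w (q.1.2 i)) = w b - w a.
  by rewrite (telescope_sumr (fun i => w (q.1.2 i)))// pa pb.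
rewrite mulr_sumr (le_trans (ler_norm_sum _ _ _))//.
apply: ler_sum_nat => i /= ni; rewrite (le_trans (normr_dot_le _ norm_dot _ _))//.
rewrite ler_pM//; first by rewrite fM// (tag_in _ _ _ _ Q).
apply: gw; [|exact: pS|].
- by have /andP[] := partition_in _ _ _ _ _ P (ltnW ni).
- by have /andP[] := partition_in _ _ _ _ _ P ni.
Qed.

Lemma RS_bound a b f g w (M : R) : a <= b -> ucont a b f -> ctrl a b g w ->
  (forall r, a <= r <= b -> `|f r| <= M) ->
  `|RS dot a b f g| <= M * (w b - w a).
Proof.
move=> ab fc gw fM; have FF := fine_partitions_filter _ _ ab.
have fg : rsable a b f g by split => //; exists w.
apply/ler_addgt0Pr => e e0.
have [d d0 h] := RS_eps _ _ _ _ _ ab fg e0.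
have [n _ [Q qd]] := grid_tagged _ _ _ ab d0.
have := rsum_bound _ _ _ _ _ _ _ gw Q fM; have := h _ Q qd.
rewrite distrC => /ltW h1 h2; rewrite -[X in `|X|](subrK (rsum dot f g (n, grid a b n, grid a b n))).
by rewrite (le_trans (ler_normD _ _))// addrC lerD.
Qed.

Lemma RS_cst a b (z : H) g : a <= b ->
  RS dot a b (fun=> z) g = dot z (g b - g a).
Proof.
move=> ab; apply: RS_unique => //.
have FF := fine_partitions_filter _ _ ab.
apply: cvg_near_cst; apply: (near_partitions _ _ _ 1) => // q [pa pb _] _.
by rewrite /rsum -dot_sumr (telescope_sumr (fun i => g (q.1.2 i)))// pa pb.
Qed.

Definition concat (q1 q2 : nat * (nat -> R) * (nat -> R)) :=
  ((q1.1.1 + q2.1.1)%N,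
   fun i => if (i <= q1.1.1)%N then q1.1.2 i else q2.1.2 (i - q1.1.1)%N,
   fun i => if (i < q1.1.1)%N then q1.2 i else q2.2 (i - q1.1.1)%N).

Lemma concatP a b c q1 q2 d : is_tagged a b q1 -> is_tagged b c q2 ->
  finer d q1 -> finer d q2 ->
  [/\ is_tagged a c (concat q1 q2), finer d (concat q1 q2) &
    forall f g, rsum dot f g (concat q1 q2) = rsum dot f g q1 + rsum dot f g q2].
Proof.
case: q1 q2 => [[n1 p1] x1] [[n2 p2] x2] [/= p1a p1b T1] [/= p2b p2c T2] /= F1 F2.
pose p i := if (i <= n1)%N then p1 i else p2 (i - n1)%N.
have pl i : (i <= n1)%N -> p i = p1 i by rewrite /p => ->.
have pr i : p (n1 + i)%N = p2 i.
  rewrite /p -[X in (_ <= X)%N]addn0 leq_add2l leqn0; case: eqVneq => [->|_].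
    by rewrite addn0 p1b p2b.
  by rewrite addnC addnK.
have cases (P : nat -> Prop) : (forall i, (i < n1)%N -> P i) ->
    (forall i, (i < n2)%N -> P (n1 + i)%N) -> forall i, (i < n1 + n2)%N -> P i.
  move=> h1 h2 i i12; have [/h1//|n1i] := ltnP i n1.
  by rewrite -(subnKC n1i); apply: h2; rewrite ltn_subLR.
split.
- split => //=.
    by have := pr n2; rewrite /p => ->.
  apply: cases => i ni /=; rewrite -/p.
    by have := pl i.+1 ni; have := pl i (ltnW ni); rewrite /p => -> ->; rewrite ni; exact: T1.
  have := pr i.+1; have := pr i; rewrite /p addnS => -> ->.
  by rewrite ltnNge leq_addr /= addKn; exact: T2.
- apply: cases => i ni /=.
    by have := pl i.+1 ni; have := pl i (ltnW ni); rewrite /p => -> ->; exact: F1.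
  by have := pr i.+1; have := pr i; rewrite /p addnS => -> ->; exact: F2.
- move=> f g; rewrite /rsum /= (big_cat_nat (n := n1)) ?leq_addr//=; congr (_ + _).
    apply: eq_big_nat => i /= ni.
    by have := pl i.+1 ni; have := pl i (ltnW ni); rewrite /p => -> ->; rewrite ni.
  rewrite -[X in \sum_(X <= _ < _) _]add0n big_addn addKn; apply: eq_big_nat => i /= ni.
  rewrite (addnC i n1); have := pr i.+1; have := pr i; rewrite /p addnS => -> ->.
  by rewrite ltnNge leq_addr /= addKn.
Qed.

Lemma finerW (d d' : R) q : d <= d' -> finer d q -> finer d' q.
Proof. by move=> dd qd i iq; apply: lt_le_trans (qd i iq) dd. Qed.

Lemma RS_split a b c f g : a <= b -> b <= c -> rsable a c f g ->
  RS dot a c f g = RS dot a b f g + RS dot b c f g.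
Proof.
move=> ab bc fg; have ac := le_trans ab bc.
apply: (eq_eps _ _ 3) => e e0.
have [d d0 h] := RS_eps _ _ _ _ _ ac fg e0.
have [d1 d10 h1] := RS_eps _ _ _ _ _ ab (rsableW _ _ _ _ _ _ (lexx a) bc fg) e0.
have [d2 d20 h2] := RS_eps _ _ _ _ _ bc (rsableW _ _ _ _ _ _ ab (lexx c) fg) e0.
pose m := Num.min d (Num.min d1 d2).
have m0 : 0 < m by rewrite !lt_min d0 d10.
have [md md1 md2] : [/\ m <= d, m <= d1 & m <= d2].
  by rewrite !ge_min !lexx !orbT.
have [n _ [Q qd]] := grid_tagged _ _ _ ab m0.
have [n' _ [Q' qd']] := grid_tagged _ _ _ bc m0.
have [Qc qdc E] := concatP _ _ _ _ _ _ Q Q' qd qd'.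
have hc := h _ Qc (finerW _ _ _ md qdc); rewrite E in hc.
have h1' := h1 _ Q (finerW _ _ _ md1 qd).
have h2' := h2 _ Q' (finerW _ _ _ md2 qd').
move: hc h1' h2'; rewrite !ltr_norml !ler_norml => /andP[? ?] /andP[? ?] /andP[? ?].
by apply/andP; split; lra.
Qed.

Lemma RS_refl a f g : rsable a a f g -> RS dot a a f g = 0.
Proof.
by move=> /(RS_split _ _ _ _ _ (lexx a) (lexx a)); lra.
Qed.

(** Summation by parts: the sums with left tags and with right tags add up to
    a telescoping sum. *)
Lemma RS_sqr a b f : a <= b -> rsable a b f f ->
  2 * RS dot a b f f = `|f b| ^+ 2 - `|f a| ^+ 2.
Proof.
move=> ab ff; apply: (eq_eps _ _ 2) => e e0.
have [d d0 h] := RS_eps _ _ _ _ _ ab ff e0.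
have [n n0 [Q qd]] := grid_tagged _ _ _ ab d0.
pose p := grid a b n; have [_ _ pS] := Q.
have Q' : is_tagged a b (n, p, fun i => p i.+1).
  by split; [exact: grid0|exact: gridn|move=> i /= ni; rewrite lexx andbT; have /andP[] := pS i ni].
have h1 := h _ Q qd; have h2 := h _ Q' qd.
suff E : rsum dot f f (n, p, p) + rsum dot f f (n, p, fun i => p i.+1) =
    `|f b| ^+ 2 - `|f a| ^+ 2.
  move: h1 h2; rewrite -E !ltr_norml !ler_norml => /andP[? ?] /andP[? ?].
  by apply/andP; split; lra.
have -> : `|f b| ^+ 2 - `|f a| ^+ 2 =
    \sum_(0 <= i < n) (`|f (p i.+1)| ^+ 2 - `|f (p i)| ^+ 2).
  by rewrite (telescope_sumr (fun i => `|f (p i)| ^+ 2))// /p gridn// grid0.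
rewrite /rsum /= -big_split; apply: eq_bigr => i _ /=.
by rewrite !norm_dot !dotE (dotC _ (f (p i.+1)) (f (p i))); ring.
Qed.

Lemma RS_chain f g n p : (forall i, (i < n)%N -> p i <= p i.+1) ->
  rsable (p 0%N) (p n) f g ->
  RS dot (p 0%N) (p n) f g = \sum_(0 <= i < n) RS dot (p i) (p i.+1) f g.
Proof.
move=> pS; elim: n pS => [|n ih] pS fg.
  rewrite big_geq//; apply: RS_unique => //.
  have FF := fine_partitions_filter _ _ (lexx (p 0%N)).
  apply: cvg_near_cst; apply: (near_partitions _ _ _ 1) => // q Q _.
  apply: big1_seq => i; rewrite mem_index_iota => /andP[_ /= iq].
  have P := tagged_partition _ _ _ Q.
  have E j : (j <= q.1.1)%N -> q.1.2 j = p 0%N.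
    by move=> jq; apply/esym/le_anti; exact: (partition_in _ _ _ _ _ P jq).
  by rewrite !E ?subrr ?dot0r// ltnW.
have pn : p 0%N <= p n.
  by apply: (@partition_mono _ _ _ n p 0 n); rewrite ?leqnn//; split => // i ni; exact/pS/ltnW.
rewrite (RS_split _ (p n))//; last exact: pS.
rewrite big_nat_recr//= ih//; first by move=> i ni; exact/pS/ltnW.
by apply: rsableW fg; [exact: lexx|exact: pS].
Qed.

Lemma RS_stieltjes a b f g : a <= b -> rsable a b f g ->
  is_stieltjes_integral dot a b f g (RS dot a b f g).
Proof.
move=> ab fg e e0; have [d d0 h] := RS_eps _ _ _ _ _ ab fg e0.
exists d => // s xi [ps ts] ms; apply: (h (size s, nth b (a :: s), xi)) => //.
by split => //=; exact: itv_partition_nth_size ps.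
Qed.

(** The sums of [is_stieltjes_integral] run over strictly increasing
    partitions only, and arbitrarily fine ones exist. *)
Lemma stieltjes_unique a b f g (l : R) : a <= b -> rsable a b f g ->
  is_stieltjes_integral dot a b f g l -> l = RS dot a b f g.
Proof.
move=> ab fg hl; apply: (eq_eps _ _ 2) => e e0.
have [d d0 h] := RS_eps _ _ _ _ _ ab fg e0.
have [d' d'0 h'] := hl _ e0.
have [s [xi [[ps ts] ms ms']]] : exists (s : seq R) xi,
    [/\ Defs.tagged_partition a b s xi, mesh_lt a b s d & mesh_lt a b s d'].
  have [E|ne] := eqVneq a b.
    by exists [::], (fun=> 0); split => //; split => //; rewrite E; split.
  have lab : a < b by rewrite lt_neqAle ne.
  have mm : 0 < Num.min d d' by rewrite lt_min d0.
  have [n n0 nd] := small_step a b _ mm.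
  pose s := mkseq (fun i => grid a b n i.+1) n.
  have nthE i : (i <= n)%N -> nth b (a :: s) i = grid a b n i.
    case: i => [|i] ni; first by rewrite /= grid0.
    by rewrite /= nth_mkseq.
  have st : 0 < (b - a) / n%:R by rewrite divr_gt0 ?subr_gt0 ?ltr0n.
  have ss : size s = n by rewrite size_mkseq.
  have ip : itv_partition a b s.
    split; last first.
      by rewrite (last_nth b) ss nthE// gridn.
    apply/(pathP b) => i; rewrite ss => ni.
    by rewrite nthE ?(ltnW ni)// nth_mkseq// gridS ltrDl.
  have ms e' : Num.min d d' <= e' -> mesh_lt a b s e'.
    move=> de p i; rewrite ss => ni; rewrite /p (nthE i.+1)// (nthE i) ?(ltnW ni)//.
    by rewrite gridS addrAC subrr add0r (lt_le_trans nd).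
  exists s, (nth b (a :: s)); split; [split => //|by apply: ms; rewrite ge_min lexx|by apply: ms; rewrite ge_min lexx orbT].
  by move=> i; rewrite ss => ni; rewrite lexx (nthE i.+1)// (nthE i) ?(ltnW ni)// gridS lerDl ltW.
have T : is_tagged a b (size s, nth b (a :: s), xi).
  by split => //=; exact: itv_partition_nth_size ps.
have := h' _ _ (conj ps ts) ms'; have := h _ T ms.
rewrite -[rsum _ _ _ _]/(stieltjes_sum dot a b f g s xi).
rewrite !ltr_norml !ler_norml => /andP[? ?] /andP[? ?].
by apply/andP; split; lra.
Qed.

End stieltjes_calculus.

(** * Uniform continuity and total variation *)

Section paths.
Context {R : realType} {H : completeNormedModType R}.
Implicit Types (a b c : R) (f g k : R -> H) (w : R -> R) (n : nat) (p : nat -> R).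

(** By compactness of the segment. *)
Lemma equicontinuous_uniform a b (M : set (R -> H)) :
  equicontinuous M (from_subspace `[a, b]) -> forall e : R, 0 < e ->
  exists2 d : R, 0 < d & forall m, M m -> forall s t, a <= s <= b -> a <= t <= b ->
    `|s - t| < d -> `|m s - m t| < e.
Proof.
move=> Meq e e0; have e2 : 0 < e / 2 by rewrite divr_gt0.
have loc t : a <= t <= b -> exists2 d, 0 < d & forall s, a <= s <= b -> `|t - s| < d ->
    forall m, M m -> `|m t - m s| < e / 2.
  move=> tab.
  have : within `[a, b] (nbhs t) [set s | forall m, M m -> ball (m t) (e / 2) (m s)].
    rewrite nbhs_subspace_in; last by rewrite /= in_itv.
    exact: (Meq t [set xy | ball xy.1 (e / 2) xy.2] (entourage_ball _ (PosNum e2))).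
  rewrite /within /= => /nbhs_ballP[d /= d0 h]; exists d => // s sab ts m Mm.
  have bs : ball t d s by rewrite -ball_normE.
  have /= := h s bs; rewrite in_itv /= => /(_ sab m Mm).
  by rewrite -ball_normE.
have cK : compact `[a, b] by exact: segment_compact.
move/compact_near_coveringP : cK => /(_ R 0^'+ (fun d t => a <= t <= b ->
  forall m s, M m -> a <= s <= b -> `|t - s| < d -> `|m t - m s| < e) _).
case=> [t|d /= d0 h].
  rewrite /= in_itv /= => tab; have [d d0 h] := loc t tab.
  have d2 : 0 < d / 2 by rewrite divr_gt0.
  exists (ball t (d / 2), [set r | r < d / 2]).
    by split; [exact: nbhsx_ballx|exact: nbhs_right_lt].
  move=> [t' r] [/=]; rewrite -ball_normE /= => tt' rd t'ab m s Mm sab t's.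
  have h1 : `|m t - m t'| < e / 2 by apply: h => //; lra.
  have h2 : `|m t - m s| < e / 2.
    apply: h => //; rewrite (_ : t - s = (t - t') + (t' - s)); last by ring.
    by rewrite (le_lt_trans (ler_normD _ _))//; lra.
  rewrite (_ : m t' - m s = (m t - m s) - (m t - m t')); last first.
    by rewrite opprB [RHS]addrC subrKA.
  by rewrite (le_lt_trans (ler_normB _ _))//; lra.
exists (d / 2); first by rewrite divr_gt0.
move=> m Mm s t sab tab st; have d2 : 0 < d / 2 by rewrite divr_gt0.
apply: (h (d / 2)) => //.
  by rewrite /= sub0r normrN gtr0_norm//; lra.
Qed.

Lemma within_ucont a b f : {within `[a, b], continuous f} -> ucont a b f.
Proof.
move=> fc.
have fe : equicontinuous [set f] (from_subspace `[a, b]).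
  move=> x E entE; have /= := fc x [set y | E (f x, y)].
  rewrite nbhs_simpl /=; have h : nbhs (f x) [set y | E (f x, y)].
    by apply: filterS (nbhs_entourage (f x) entE) => y; rewrite /xsection /= inE.
  by move/(_ h); apply: filterS => y Ey _ ->.
move=> e e0; have [d d0 h] := equicontinuous_uniform a b _ fe e e0.
by exists d => // s t; exact: h.
Qed.

Lemma ucont_within a b f : ucont a b f -> {within `[a, b], continuous f}.
Proof.
move=> fc; apply/subspace_continuousP => x; rewrite /= in_itv /= => xab.
apply/cvgrPdist_lt => e e0; have [d d0 h] := fc e e0.
rewrite near_withinE; near=> y => /=; rewrite in_itv /= => yab.
apply: h => //; near: y; exact: nbhsx_ballx.
Unshelve. all: by end_near. Qed.

Lemma ucont_max a b f : a <= b -> ucont a b f ->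
  exists2 c, a <= c <= b & forall t, a <= t <= b -> `|f t| <= `|f c|.
Proof.
move=> ab /ucont_within fc.
have nc : {within `[a, b], continuous (fun t => `|f t|)}.
  by move=> x; apply: cvg_norm; exact: fc.
have [c cab h] := EVT_max ab nc.
by exists c => [|t tab]; [move: cab|apply: h]; rewrite in_itv.
Qed.

Lemma supnorm_ge (T : R) f (B : R) : (forall t, 0 <= t <= T -> `|f t| <= B) ->
  forall t, 0 <= t <= T -> `|f t| <= supnorm T f.
Proof.
move=> fB t tT; apply: ub_le_sup; last by exists t => //; rewrite /= in_itv.
by exists B => _ [s + <-]; rewrite /= in_itv /=; exact: fB.
Qed.

Lemma supnorm_le (T : R) f (B : R) : 0 <= T -> (forall t, 0 <= t <= T -> `|f t| <= B) ->
  supnorm T f <= B.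
Proof.
move=> T0 fB; apply: ge_sup.
  by exists `|f 0|, 0 => //; rewrite /= in_itv /= lexx.
by move=> _ [s + <-]; rewrite /= in_itv /=; exact: fB.
Qed.

Definition vsum g n p : R := \sum_(0 <= i < n) `|g (p i.+1) - g (p i)|.

(** For [g] of bounded variation, [vtotal_variation 0 t g] as a real number:
    the smallest control of [g] that vanishes at [0]. *)
Definition varf g (t : R) : R :=
  sup [set v | exists n p, is_partition 0 t n p /\ v = vsum g n p].

Definition var_le a b g (B : R) := forall n p, is_partition a b n p -> vsum g n p <= B.

Lemma ctrl_var_le a b g w : ctrl a b g w -> var_le a b g (w b - w a).
Proof.
move=> gw n p P; have [pa pb pS] := P.
rewrite -pa -pb -(telescope_sumr (fun i => w (p i)))//; apply: ler_sum_nat => i /= ni.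
apply: gw; [|exact: pS|].
- by have /andP[] := partition_in _ _ _ _ _ P (ltnW ni).
- by have /andP[] := partition_in _ _ _ _ _ P ni.
Qed.

Lemma vsum_extend a b c g n p : is_partition a b n p -> b <= c ->
  exists p', is_partition a c n.+1 p' /\ vsum g n.+1 p' = vsum g n p + `|g c - g b|.
Proof.
move=> [pa pb pS] bc; exists (fun i => if (i <= n)%N then p i else c).
split.
  split=> [//||i]; first by rewrite ltnn.
  rewrite ltnS leq_eqVlt => /predU1P[->|ni]; first by rewrite eqxx ltnn pb.
  by rewrite ni orbT pS.
rewrite /vsum big_nat_recr//= ltnn leqnn pb; congr (_ + _).
by apply: eq_big_nat => i /= ni; rewrite ni ltnW.
Qed.

Lemma var_leW a b b' g B : b <= b' -> var_le a b' g B -> var_le a b g B.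
Proof.
move=> bb gB n p P; have [p' [P' E]] := vsum_extend _ _ _ g _ _ P bb.
by apply: le_trans (gB _ _ P'); rewrite E lerDl.
Qed.

Lemma partition_const (t : R) : is_partition t t 0 (fun=> t).
Proof. by []. Qed.

Lemma partition_nil (t : R) : 0 <= t -> is_partition 0 t 1 (fun i => if i == 0%N then 0 else t).
Proof. by move=> t0; split => // -[]. Qed.

Lemma varf_has_sup (t B : R) g : 0 <= t -> var_le 0 t g B ->
  has_sup [set v | exists n p, is_partition 0 t n p /\ v = vsum g n p].
Proof.
move=> t0 gB; split; last by exists B => _ [n [p [P ->]]]; exact: gB.
by eexists; exists 1%N, (fun i => if i == 0%N then 0 else t); split; first exact: partition_nil.
Qed.

Lemma vsum_varf (t B : R) g n p : 0 <= t -> var_le 0 t g B ->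
  is_partition 0 t n p -> vsum g n p <= varf g t.
Proof.
move=> t0 gB P; apply: ub_le_sup; last by exists n, p.
by have [] := varf_has_sup t B g t0 gB.
Qed.

Lemma varf_le_bound (t B : R) g : 0 <= t -> var_le 0 t g B -> varf g t <= B.
Proof.
move=> t0 gB; apply: ge_sup; first by have [] := varf_has_sup t B g t0 gB.
by move=> _ [n [p [P ->]]]; exact: gB.
Qed.

Lemma varf0 g : varf g 0 = 0.
Proof.
have B0 : var_le 0 0 g 0.
  move=> n p P; rewrite /vsum big1_seq// => i; rewrite mem_index_iota => /andP[_ /= ni].
  have E j : (j <= n)%N -> p j = 0.
    by move=> jn; apply/esym/le_anti; exact: (partition_in _ _ _ _ _ P jn).
  by rewrite !E ?subrr ?normr0// ltnW.
apply/le_anti; rewrite varf_le_bound//=.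
by have := vsum_varf _ _ _ _ _ (lexx 0) B0 (partition_const 0); rewrite /vsum big_geq.
Qed.

Lemma varf_ctrl (T B : R) g : var_le 0 T g B -> ctrl 0 T g (varf g).
Proof.
move=> gB s t s0 st tT; have t0 := le_trans s0 st.
have gBt : var_le 0 t g B by exact: var_leW gB.
have gBs : var_le 0 s g B by exact: var_leW gBt.
rewrite lerBrDl -lerBrDr; apply: ge_sup; first by have [] := varf_has_sup s B g s0 gBs.
move=> _ [n [p [P ->]]]; rewrite lerBrDr.
have [p' [P' <-]] := vsum_extend _ _ _ g _ _ P st.
exact: vsum_varf gBt P'.
Qed.

(** Additivity of the variation: a partition of [[0, t]] is clamped to
    [[0, s]] and to [[s, t]]. *)
Lemma varf_split (s t B V : R) g : 0 <= s -> s <= t -> var_le 0 t g V ->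
  var_le s t g B -> varf g t - varf g s <= B.
Proof.
move=> s0 st gV gB; have t0 := le_trans s0 st.
have gVs : var_le 0 s g V by exact: var_leW gV.
rewrite lerBlDr; apply: ge_sup; first by have [] := varf_has_sup t V g t0 gV.
move=> _ [n [p [[p0 pt pS] ->]]].
have P1 : is_partition 0 s n (fun i => Num.min (p i) s).
  split; rewrite ?p0 ?pt; [exact: min_idPl|exact: min_idPr|move=> i /pS h].
  by rewrite le_min ge_min h ge_min lexx orbT.
have P2 : is_partition s t n (fun i => Num.max (p i) s).
  split; rewrite ?p0 ?pt; [exact: max_idPr|exact: max_idPl|move=> i /pS h].
  by rewrite ge_max le_max h le_max lexx orbT.
have h1 := vsum_varf _ _ _ _ _ s0 gVs P1; have h2 := gB _ _ P2.
apply: (le_trans _ (lerD h2 h1)); rewrite -big_split; apply: ler_sum_nat => i /= /pS pi.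
have [ps|ps] := leP (p i.+1) s.
  have [ps'|ps'] := leP (p i) s; first by rewrite lerDr.
  by have := lt_le_trans ps' pi; rewrite ltNge ps.
have [ps'|ps'] := leP (p i) s; last by rewrite lerDl.
rewrite (_ : g (p i.+1) - g (p i) = (g (p i.+1) - g s) + (g s - g (p i))).
  exact: ler_normD.
by rewrite subrKA.
Qed.

(** Dropping the repetitions of a partition does not change its variation. *)
Lemma partition_list a n p g : p 0%N = a -> (forall i, (i < n)%N -> p i <= p i.+1) ->
  exists2 s, itv_partition a (p n) s & vvariation a (p n) g s = vsum g n p.
Proof.
move=> pa; elim: n => [|n ih] pS.
  by exists [::]; [split; rewrite /= ?pa|rewrite /vvariation /vsum !big_geq].
have [i ni|s sp E] := ih; first exact/pS/ltnW.
have [pE|pne] := eqVneq (p n.+1) (p n).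
  exists s; first by rewrite pE.
  by rewrite /vsum big_nat_recr//= pE subrr normr0 addr0 E.
exists (rcons s (p n.+1)).
  case: sp => sp /eqP sl; split; last by rewrite last_rcons.
  by rewrite rcons_path sp sl /= lt_neqAle eq_sym pne pS.
rewrite /vsum big_nat_recr//= -/(vsum g n p) -E /vvariation size_rcons big_nat_recr//=.
have sn : nth (p n.+1) (a :: s) (size s) = p n.
  by rewrite -(last_nth (p n.+1)); case: sp => _ /eqP.
rewrite -rcons_cons !nth_rcons /= ltnn eqxx ltnS leqnn sn; congr (_ + _).
apply: eq_big_nat => i /= ni; rewrite -rcons_cons !nth_rcons /= !ltnS ni ltnW//.
by rewrite !(set_nth_default (p n.+1) (p n))//= ltnS// ltnW.
Qed.

Lemma BV0_var_le (T : R) k : BV0 T k -> exists B, var_le 0 T k B.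
Proof.
move=> [kT _]; exists (fine (vtotal_variation 0 T k)) => n p [p0 pT pS].
have [s + E] := partition_list 0 n p k p0 pS; rewrite pT in E * => sp.
have h : ((vvariation 0 T k s)%:E <= vtotal_variation 0 T k)%E.
  by apply: ereal_sup_ubound; exists s.
rewrite -E -lee_fin fineK// ge0_fin_numE// (le_trans _ h)// lee_fin.
by apply: sumr_ge0.
Qed.

Lemma vtotal_variation_le (T B : R) k : 0 <= T -> var_le 0 T k B ->
  (vtotal_variation 0 T k <= B%:E)%E.
Proof.
move=> T0 kB; apply: ub_ereal_sup => _ [s sp <-]; rewrite lee_fin.
apply: (kB (size s) (nth T (0 :: s))); split => //=.
  exact: itv_partition_nth_size sp.
move=> i si; case: (sp) => /(pathP T) /(_ i si) h _; exact: ltW.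
Qed.

End paths.

(** * Approximate solutions and energy estimates *)

Section approximate_solutions.
Context {R : realType} {H : completeNormedModType R} (dot : {dot H for idfun})
  (norm_dot : forall u : H, `|u| ^+ 2 = dot u u) (A : set (H * H)).
Implicit Types (a b c T : R) (f g m k : R -> H) (w : R -> R) (n : nat).

(** Solutions up to an error [delta].  The class contains both the solutions,
    for [delta = 0], and the Euler approximations, so that the same estimates
    serve for both.  The error is proportional to the variation of the
    integrator [k - r zs] rather than to the length of the interval: this is
    what replacing [x] by a path at distance [delta] costs. *)
Record aGSP T (delta : R) (x0 : H) m (x : R -> H) k : Prop := {
  aGSP_x : ucont 0 T x ;
  aGSP_k : ucont 0 T k ;
  aGSP_k0 : k 0 = 0 ;
  aGSP_bv : exists B, var_le 0 T k B ;
  aGSP_eq : forall t, 0 <= t <= T -> x t + k t = x0 + m t ;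
  aGSP_ineq : forall z zs, A (z, zs) -> forall s t, 0 <= s -> s <= t -> t <= T ->
    - (delta * (varf k t - varf k s + `|zs| * (t - s))) <=
    RS dot s t (fun r => x r - z) (fun r => k r - r *: zs)
}.

Lemma aGSP_ctrl T d x0 m x k : aGSP T d x0 m x k -> ctrl 0 T k (varf k).
Proof. by case=> _ _ _ [B /varf_ctrl]. Qed.

Lemma aGSP_m T d x0 m x k : aGSP T d x0 m x k -> ucont 0 T m.
Proof.
move=> X e e0; have [d' d'0 h] := ucontD _ _ _ _ (aGSP_x _ _ _ _ _ _ X) (aGSP_k _ _ _ _ _ _ X) e e0.
exists d' => // s t sT tT st; have := h s t sT tT st.
by rewrite !(aGSP_eq _ _ _ _ _ _ X)// opprD addrACA subrr add0r.
Qed.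

Lemma aGSP_rsable T d x0 m x k z zs : aGSP T d x0 m x k ->
  rsable 0 T (fun r => x r - z) (fun r => k r - r *: zs).
Proof.
move=> X; split; first by apply: ucontB; [exact: aGSP_x X|exact: ucont_cst].
exists (fun r => varf k r + r * `|zs|); apply: ctrlB; first exact: aGSP_ctrl X.
exact: ctrl_lin.
Qed.

Lemma aGSP_rsablek T d x0 m x k z : aGSP T d x0 m x k ->
  rsable 0 T (fun r => x r - z) k.
Proof.
move=> X; split; first by apply: ucontB; [exact: aGSP_x X|exact: ucont_cst].
exists (varf k); exact: aGSP_ctrl X.
Qed.

Lemma GSP_aGSP T x0 m x k : GSP dot A T x0 m x k -> aGSP T 0 x0 m x k.
Proof.
case=> xc xd kc kbv xk xi; have [B kB] := BV0_var_le _ _ kbv.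
have xu := within_ucont _ _ _ xc; have ku := within_ucont _ _ _ kc.
have [_ k0] := kbv; split => //; first by exists B.
move=> z zs Az s t s0 st tT; have [l sl l0] := xi z zs Az s t s0 st tT.
rewrite mul0r oppr0 -(stieltjes_unique dot norm_dot _ _ _ _ l st _ sl)//.
apply: (rsableW 0 T) => //; split; first by apply: ucontB => //; exact: ucont_cst.
exists (fun r => varf k r + r * `|zs|).
by apply: ctrlB; [exact: varf_ctrl kB|exact: ctrl_lin].
Qed.

Lemma aGSP_GSP T x0 m x k : 0 <= T -> aGSP T 0 x0 m x k ->
  (forall t, 0 <= t <= T -> closure (Dom A) (x t)) -> GSP dot A T x0 m x k.
Proof.
move=> T0 X xd; split => //.
- by apply: ucont_within; exact: aGSP_x X.
- by apply: ucont_within; exact: aGSP_k X.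
- split; last exact: aGSP_k0 X.
  have [B /(vtotal_variation_le _ _ _ T0) h] := aGSP_bv _ _ _ _ _ _ X.
  exact: le_lt_trans h (ltry _).
- exact: aGSP_eq X.
- move=> z zs Az s t s0 st tT.
  exists (RS dot s t (fun r => x r - z) (fun r => k r - r *: zs)).
    apply: (RS_stieltjes dot norm_dot) => //; apply: (rsableW 0 T) => //; exact: aGSP_rsable X.
  by have := aGSP_ineq _ _ _ _ _ _ X z zs Az s t s0 st tT; rewrite mul0r oppr0.
Qed.

(** In this section [u0], [rho] and [mu] are those of [interior_support]. *)
Section energy.
Context (u0 : H) (rho mu : R) (rho0 : 0 < rho) (mu0 : 0 <= mu)
  (support : forall d : H, exists z zs, [/\ A (z, zs), rho * `|d| <= dot (z - u0) d,
    `|z - u0| <= 3 * rho & `|zs| <= mu]).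
Context (T : R) (T0 : 0 < T).

(** The inequality of the problem at the point of the graph that lies in the
    direction of the increment of [k]. *)
Lemma increment_bound d x0 m x k a b (S : R) : aGSP T d x0 m x k -> 0 <= d ->
  0 <= a -> a <= b -> b <= T -> (forall r, a <= r <= b -> `|x r - u0| <= S) ->
  rho * `|k b - k a| <= RS dot a b (fun r => x r - u0) k +
    mu * (b - a) * (S + 3 * rho + d) + d * (varf k b - varf k a).
Proof.
move=> X d0 a0 ab bT xS.
have S0 : 0 <= S by rewrite (le_trans _ (xS a _))// lexx.
have [z [zs [Az h1 h2 h3]]] := support (k b - k a).
apply: le_trans h1 _.
have := aGSP_ineq _ _ _ _ _ _ X z zs Az a b a0 ab bT.
have lin : rsable a b (fun r => x r - z) (fun r => r *: zs).
  apply: (rsableW 0 T) => //; split; last by exists (fun r => r * `|zs|); exact: ctrl_lin.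
  by apply: ucontB; [exact: aGSP_x X|exact: ucont_cst].
have xk v : rsable a b (fun r => x r - v) k.
  by apply: (rsableW 0 T) => //; exact: aGSP_rsablek X.
rewrite RSBr//.
have -> : RS dot a b (fun r => x r - z) k =
    RS dot a b (fun r => x r - u0) k - dot (z - u0) (k b - k a).
  rewrite -(RS_cst dot a b (z - u0) k ab) -RSBl//; last first.
    by split; [exact: ucont_cst|have [_] := xk u0].
  apply: (RS_ext dot norm_dot) => // [|r _]; last by rewrite opprB addrA subrK.
  split; last by have [_] := xk u0.
  by apply: ucontB; [have [] := xk u0|exact: ucont_cst].
have : `|RS dot a b (fun r => x r - z) (fun r => r *: zs)| <=
    (S + 3 * rho) * (b * `|zs| - a * `|zs|).
  apply: (RS_bound dot norm_dot _ _ _ _ (fun r => r * `|zs|)) => //; [by have [] := lin|exact: ctrl_lin|move=> r rab].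
  rewrite (_ : x r - z = (x r - u0) - (z - u0)); last by rewrite opprB addrA subrK.
  by rewrite (le_trans (ler_normB _ _))// lerD// xS.
rewrite -mulrBl ler_norml => /andP[h4 _].
have h5 : (S + 3 * rho + d) * ((b - a) * `|zs|) <= (S + 3 * rho + d) * ((b - a) * mu).
  by rewrite ler_wpM2l ?addr_ge0 ?mulr_ge0 ?(ltW rho0)// ler_wpM2l// subr_ge0.
by move: h4 h5; set q := dot _ _; set q1 := RS _ _ _ _ _; set q2 := RS _ _ _ _ _; lra.
Qed.

(** [increment_bound] on the cells of a partition, summed up: the integrals are
    additive, so the left-hand side can be the variation. *)
Lemma variation_bound d x0 m x k a b (S : R) : aGSP T d x0 m x k -> 0 <= d ->
  0 <= a -> a <= b -> b <= T -> (forall r, a <= r <= b -> `|x r - u0| <= S) ->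
  rho * (varf k b - varf k a) <= RS dot a b (fun r => x r - u0) k +
    mu * (b - a) * (S + 3 * rho + d) + d * (varf k b - varf k a).
Proof.
move=> X d0 a0 ab bT xS.
rewrite -ler_pdivlMl//; have [B kB] := aGSP_bv _ _ _ _ _ _ X.
apply: (varf_split a b _ B) => //; first exact: var_leW kB.
move=> n p P; rewrite ler_pdivlMl// mulr_sumr; have [pa pb pS] := P.
have -> : RS dot a b (fun r => x r - u0) k =
    \sum_(0 <= i < n) RS dot (p i) (p i.+1) (fun r => x r - u0) k.
  rewrite -pa -pb; apply: (RS_chain dot norm_dot) => //; rewrite pa pb.
  by apply: (rsableW 0 T) => //; exact: aGSP_rsablek X.
have -> : mu * (b - a) * (S + 3 * rho + d) =
    \sum_(0 <= i < n) mu * (p i.+1 - p i) * (S + 3 * rho + d).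
  by rewrite -mulr_suml -mulr_sumr telescope_sumr// pa pb.
have -> : d * (varf k b - varf k a) = \sum_(0 <= i < n) d * (varf k (p i.+1) - varf k (p i)).
  by rewrite -mulr_sumr (telescope_sumr (fun i => varf k (p i)))// pa pb.
rewrite -!big_split; apply: ler_sum_nat => i /= ni.
have /andP[h1 _] := partition_in _ _ _ _ _ P (ltnW ni).
have /andP[_ h2] := partition_in _ _ _ _ _ P ni.
apply: (increment_bound _ x0 m) => //; [exact: le_trans h1|exact: pS|exact: le_trans h2 _|].
move=> r /andP[? ?]; apply: xS; apply/andP; split; [exact: le_trans h1 _|exact: le_trans h2].
Qed.

(** The chain rule for [|y|^2], where [y = x - u0 - (m - m a)] has the
    increments of [- k].  The oscillation of [m] is absorbed by the variation
    of [k], which is why it has to be small. *)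
Lemma energy_bound d x0 m x k a b (S : R) : aGSP T d x0 m x k -> 0 <= d -> d <= rho / 4 ->
  0 <= a -> a <= b -> b <= T -> (forall r, a <= r <= b -> `|x r - u0| <= S) ->
  (forall r, a <= r <= b -> `|m r - m a| <= rho / 4) ->
  `|x b - u0 - (m b - m a)| ^+ 2 + rho * (varf k b - varf k a) <=
  `|x a - u0| ^+ 2 + 2 * mu * T * (S + 4 * rho).
Proof.
move=> X d0 dr a0 ab bT xS mr.
have S0 : 0 <= S by rewrite (le_trans _ (xS a _))// lexx.
have aT := le_trans ab bT; have b0 := le_trans a0 ab.
have inT r : a <= r <= b -> 0 <= r <= T.
  by move=> /andP[h1 h2]; rewrite (le_trans a0 h1) (le_trans h2 bT).
pose y r := x r - u0 - (m r - m a).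
have yE r : a <= r <= b -> y r = x0 + m a - u0 - k r.
  move=> /inT /(aGSP_eq _ _ _ _ _ _ X) E; apply: (dot_ext dot norm_dot) => v.
  have : dot (x r + k r) v = dot (x0 + m r) v by rewrite E.
  by rewrite /y !dotE; lra.
have kc : ctrl a b k (varf k) by apply: (ctrlW 0 T) => //; exact: aGSP_ctrl X.
have xu : ucont a b (fun r => x r - u0).
  by apply: (ucontW 0 T) => //; apply: ucontB; [exact: aGSP_x X|exact: ucont_cst].
have mu' : ucont a b (fun r => m r - m a).
  by apply: (ucontW 0 T) => //; apply: ucontB; [exact: aGSP_m X|exact: ucont_cst].
have yu : ucont a b y by exact: ucontB.
have yk : rsable a b y k by split => //; exists (varf k).
have yyk : rsable a b y (fun r => - k r) by split => //; exists (varf k); exact: ctrlN.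
have incr s t : a <= s -> s <= t -> t <= b -> y t - y s = - k t - - k s.
  move=> as_ st tb; rewrite !yE ?as_ ?(le_trans st)// ?(le_trans as_)//.
  by rewrite opprB addrC addrA subrK opprK addrC.
have yy : rsable a b y y.
  by split => //; exists (varf k) => s t as_ st tb; rewrite incr//; exact: (ctrlN _ _ _ _ kc).
have E : 2 * RS dot a b y y = `|y b| ^+ 2 - `|x a - u0| ^+ 2.
  by rewrite RS_sqr// /y subrr subr0.
have E1 : RS dot a b y y = - (RS dot a b (fun r => x r - u0) k - RS dot a b (fun r => m r - m a) k).
  rewrite -RSBl//; [|by split => //; exists (varf k)|by split => //; exists (varf k)].
  by rewrite -RSNr//; apply: (RS_ext dot norm_dot).
have h1 := variation_bound _ _ _ _ _ _ _ _ X d0 a0 ab bT xS.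
have h2 := RS_bound dot norm_dot _ _ _ _ _ _ ab mu' kc mr.
have v0 : 0 <= varf k b - varf k a by rewrite subr_ge0 (ctrl_mono _ _ _ _ _ _ kc).
have h3 : d * (varf k b - varf k a) <= rho / 4 * (varf k b - varf k a) by rewrite ler_wpM2r.
have h4 : mu * (b - a) * (S + 3 * rho + d) <= mu * T * (S + 4 * rho).
  apply: ler_pM; [|by rewrite !addr_ge0 ?mulr_ge0 ?(ltW rho0)| |by lra].
    by rewrite mulr_ge0// subr_ge0.
  by rewrite ler_wpM2l//; lra.
move: h2; rewrite ler_norml => /andP[_ h2].
rewrite -/(y b); move: E h1 h2 h3 h4; rewrite E1.
by set q1 := RS _ _ _ _ _; set q2 := RS _ _ _ _ _; lra.
Qed.

(** [energy_bound] up to the point where [|x - u0|] is largest bounds this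
    maximum by itself, but only linearly, so that Young's inequality absorbs
    it. *)
Lemma cell_bound : exists2 C, 1 <= C & forall d x0 m x k a b,
  aGSP T d x0 m x k -> 0 <= d -> d <= rho / 4 -> 0 <= a -> a <= b -> b <= T ->
  (forall r, a <= r <= b -> `|m r - m a| <= rho / 4) ->
  (forall r, a <= r <= b -> `|x r - u0| ^+ 2 <= C * (1 + `|x a - u0| ^+ 2)) /\
  varf k b - varf k a <= C * (1 + `|x a - u0| ^+ 2).
Proof.
(* the coefficients are those that the uses of Young's inequality require *)
pose E := 17 * (mu * T) ^+ 2 + 40 * (mu * T) * rho + rho ^+ 2 / 4.
have E0 : 0 <= E.
  by rewrite /E !addr_ge0 ?mulr_ge0 ?sqr_ge0 ?(ltW rho0) ?(ltW T0).
have q0 : 0 <= (5 + 2 * E) / rho by rewrite divr_ge0 ?(ltW rho0)//; lra.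
exists (4 + E + (5 + 2 * E) / rho); first lra.
move=> d x0 m x k a b X d0 dr a0 ab bT mr.
have xu : ucont a b (fun r => x r - u0).
  by apply: (ucontW 0 T) => //; apply: ucontB; [exact: aGSP_x X|exact: ucont_cst].
have [c /andP[ac cb] cmax] := ucont_max _ _ _ ab xu.
set D := `|x a - u0| ^+ 2; have D0 : 0 <= D by exact: sqr_ge0.
have S2 : `|x c - u0| ^+ 2 <= 4 * D + E.
  have := energy_bound d x0 m x k a c `|x c - u0| X d0 dr a0 ac (le_trans cb bT).
  have v0 : 0 <= rho * (varf k c - varf k a).
    by rewrite mulr_ge0 ?(ltW rho0)// subr_ge0 (ctrl_mono _ _ _ _ _ _ (aGSP_ctrl _ _ _ _ _ _ X))// (le_trans cb).
  have cb' r : a <= r <= c -> a <= r <= b.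
    by move=> /andP[-> rc]; rewrite (le_trans rc cb).
  move=> /(_ (fun r rc => cmax r (cb' r rc)) (fun r rc => mr r (cb' r rc))) h.
  have h1 := sqr_normD_le dot norm_dot (x c - u0 - (m c - m a)) (m c - m a).
  rewrite subrK in h1.
  have h2 : `|m c - m a| ^+ 2 <= (rho / 4) ^+ 2.
    by rewrite ler_pXn2r// ?nnegrE ?divr_ge0 ?(ltW rho0)// mr// ac.
  (* Young's inequality *)
  have h3 : 0 <= (`|x c - u0| - 4 * (mu * T)) ^+ 2 by exact: sqr_ge0.
  have h4 : 0 <= (mu * T) ^+ 2 by exact: sqr_ge0.
  have h5 : 0 <= mu * T * rho by rewrite !mulr_ge0 ?(ltW rho0) ?(ltW T0).
  move: h v0 h1 h2 h3 h4 h5; rewrite /E -/D !expr2.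
  by set q := `|_ - _ - _|; set S := `|x c - u0|; set q1 := `|_ - _|; lra.
have hv : rho * (varf k b - varf k a) <= 5 * D + 2 * E.
  have h := energy_bound d x0 m x k a b `|x c - u0| X d0 dr a0 ab bT cmax mr.
  have h2 : 0 <= `|x b - u0 - (m b - m a)| ^+ 2 by exact: sqr_ge0.
  have h3 : 0 <= (`|x c - u0| - (mu * T)) ^+ 2 by exact: sqr_ge0.
  have h4 : 0 <= (mu * T) ^+ 2 by exact: sqr_ge0.
  have h5 : 0 <= mu * T * rho by rewrite !mulr_ge0 ?(ltW rho0) ?(ltW T0).
  have h6 : 0 <= rho ^+ 2 by exact: sqr_ge0.
  move: h S2 h2 h3 h4 h5 h6; rewrite -/D {1}/E /E !expr2.
  by set q := `|_ - _ - _|; set S := `|x c - u0|; lra.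
have ED : 0 <= E * D by rewrite mulr_ge0.
split=> [r rab|].
  apply: (@le_trans _ _ (4 * D + E)).
    by apply: le_trans S2; rewrite ler_pXn2r ?nnegrE// cmax.
  have : 0 <= (5 + 2 * E) / rho * (1 + D) by rewrite mulr_ge0// addr_ge0.
  lra.
apply: (@le_trans _ _ ((5 + 2 * E) / rho * (1 + D))).
  rewrite mulrAC ler_pdivlMr// mulrC; apply: le_trans hv _.
  by move: ED; lra.
have : 0 <= (4 + E) * (1 + D) by apply: mulr_ge0; lra.
lra.
Qed.

(** The bound of one cell is iterated over a subdivision on whose cells [m]
    oscillates little; the constant depends on [m] through the number of cells
    only. *)
Lemma apriori N : (0 < N)%N -> exists2 C, 1 <= C & forall d x0 m x k,
  aGSP T d x0 m x k -> 0 <= d -> d <= rho / 4 -> m 0 = 0 ->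
  (forall i, (i < N)%N -> forall r, grid 0 T N i <= r <= grid 0 T N i.+1 ->
     `|m r - m (grid 0 T N i)| <= rho / 4) ->
  (forall t, 0 <= t <= T -> `|x t| ^+ 2 <= C * (1 + `|x0| ^+ 2)) /\
  varf k T <= C * (1 + `|x0| ^+ 2).
Proof.
move=> N0; have [C C1 hC] := cell_bound.
have P := grid_partition _ _ _ (ltW T0) N0; have [g0 gN gS] := P.
have [b b1 hb] : exists2 b, 1 <= b & forall d x0 m x k,
  aGSP T d x0 m x k -> 0 <= d -> d <= rho / 4 -> m 0 = 0 ->
  (forall i, (i < N)%N -> forall r, grid 0 T N i <= r <= grid 0 T N i.+1 ->
     `|m r - m (grid 0 T N i)| <= rho / 4) ->
  (forall t, 0 <= t <= T -> `|x t - u0| ^+ 2 <= b * (1 + `|x0 - u0| ^+ 2)) /\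
  varf k T <= b * (1 + `|x0 - u0| ^+ 2).
  suff : forall i, (i <= N)%N -> exists2 b, 1 <= b & forall d x0 m x k,
    aGSP T d x0 m x k -> 0 <= d -> d <= rho / 4 -> m 0 = 0 ->
    (forall i, (i < N)%N -> forall r, grid 0 T N i <= r <= grid 0 T N i.+1 ->
     `|m r - m (grid 0 T N i)| <= rho / 4) ->
    (forall t, 0 <= t <= grid 0 T N i -> `|x t - u0| ^+ 2 <= b * (1 + `|x0 - u0| ^+ 2)) /\
    varf k (grid 0 T N i) <= b * (1 + `|x0 - u0| ^+ 2).
    by move=> /(_ N (leqnn N)); rewrite gN.
  elim=> [_|i ih iN].
    exists 1 => // d x0 m x k X d0 dr m0 _; rewrite g0.
    have xE : x 0 = x0.
      have := aGSP_eq _ _ _ _ _ _ X 0; rewrite (aGSP_k0 _ _ _ _ _ _ X) m0 !addr0.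
      by apply; rewrite lexx ltW.
    split=> [t t0|]; last by rewrite varf0 mul1r addr_ge0.
    by rewrite -(le_anti t0) xE mul1r lerDr.
  have [b b1 hb] := ih (ltnW iN); exists (b + C * (1 + b)).
    by rewrite (le_trans b1)// lerDl mulr_ge0// ?addr_ge0//; lra.
  move=> d x0 m x k X d0 dr m0 osc.
  have [hx hv] := hb d x0 m x k X d0 dr m0 osc.
  have /andP[gi0 giT] := partition_in _ _ _ _ _ P (ltnW iN).
  have /andP[gi'0 gi'T] := partition_in _ _ _ _ _ P iN.
  have [cx cv] := hC d x0 m x k _ _ X d0 dr gi0 (gS i iN) gi'T (osc i iN).
  set D := `|x0 - u0| ^+ 2 in hx hv *; have D0 : 0 <= D by exact: sqr_ge0.
  have h1 : C * (1 + `|x (grid 0 T N i) - u0| ^+ 2) <= C * (1 + b) * (1 + D).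
    rewrite -mulrA ler_wpM2l//; first lra.
    have := hx (grid 0 T N i); rewrite gi0 lexx => /(_ isT); lra.
  have bD : 0 <= b * (1 + D) by rewrite mulr_ge0 ?addr_ge0//; lra.
  have CD : 0 <= C * (1 + b) * (1 + D) by rewrite !mulr_ge0 ?addr_ge0//; lra.
  split=> [t /andP[t0 ti]|]; last first.
    by rewrite mulrDl; move: cv h1 hv; lra.
  have [tg|gt] := leP t (grid 0 T N i).
    by rewrite (le_trans (hx t _)) ?t0//; lra.
  by rewrite (le_trans (cx t _)) ?(ltW gt)// (le_trans h1)//; lra.
pose U := `|u0| ^+ 2; have U0 : 0 <= U by exact: sqr_ge0.
have c1 : 2 + 2 * U <= 2 * b * (2 + 2 * U).
  rewrite -[leLHS]mul1r ler_wpM2r//; lra.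
exists (2 * b * (2 + 2 * U) + 2 * U); first by lra.
move=> d x0 m x k X d0 dr m0 osc; have [hx hv] := hb d x0 m x k X d0 dr m0 osc.
have h : 1 + `|x0 - u0| ^+ 2 <= (2 + 2 * U) * (1 + `|x0| ^+ 2).
  have := sqr_normD_le dot norm_dot x0 (- u0); rewrite normrN -/U.
  have : 0 <= U * `|x0| ^+ 2 by rewrite mulr_ge0.
  by lra.
have h' : b * (1 + `|x0 - u0| ^+ 2) <= b * (2 + 2 * U) * (1 + `|x0| ^+ 2).
  by rewrite -mulrA ler_wpM2l//; lra.
have n0 : 0 <= U * `|x0| ^+ 2 by rewrite mulr_ge0.
have n1 : 0 <= b * (2 + 2 * U) * (1 + `|x0| ^+ 2).
  by rewrite !mulr_ge0 ?addr_ge0//; lra.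
split=> [t tT|].
  have := sqr_normD_le dot norm_dot (x t - u0) u0; rewrite subrK -/U.
  by have := hx t tT; lra.
by lra.
Qed.

End energy.
End approximate_solutions.

(** * Comparison with Euler approximations *)

Section euler_approximations.
Context {R : realType} {H : completeNormedModType R} (dot : {dot H for idfun})
  (norm_dot : forall u : H, `|u| ^+ 2 = dot u u) (A : set (H * H))
  (Amon : monotone_op dot A).
Implicit Types (a b c T : R) (f g m k : R -> H) (w : R -> R) (n : nat).

Lemma osc_grid T (M : set (R -> H)) (d e : R) : 0 < T -> 0 < d ->
  (forall m, M m -> forall s t, 0 <= s <= T -> 0 <= t <= T -> `|s - t| < d -> `|m s - m t| < e) ->
  exists2 N, (0 < N)%N & forall m, M m -> forall i, (i < N)%N ->
    forall r, grid 0 T N i <= r <= grid 0 T N i.+1 -> `|m r - m (grid 0 T N i)| <= e.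
Proof.
move=> T0 d0 h; have [N N0 Nd] := small_step 0 T _ d0; exists N => // m Mm i iN r /andP[r1 r2].
have P := grid_partition _ _ _ (ltW T0) N0.
have /andP[h1 h1'] := partition_in _ _ _ _ _ P (ltnW iN).
have /andP[h2 h2'] := partition_in _ _ _ _ _ P iN.
apply: ltW; apply: h => //.
- by rewrite (le_trans h1 r1) (le_trans r2 h2').
- by rewrite h1.
- rewrite ger0_norm ?subr_ge0//; apply: le_lt_trans Nd.
  by rewrite lerBlDl -gridS.
Qed.

(** The points [max a (min b t_i)], for [t_i] on the grid, cut [[a, b]] into
    intervals that are reduced to a point or lie inside a cell. *)
Lemma cell_chain T n (P : R -> R -> Prop) : 0 < T -> (0 < n)%N ->
  (forall a, 0 <= a <= T -> P a a) ->
  (forall a b c, 0 <= a -> a <= b -> b <= c -> c <= T -> P a b -> P b c -> P a c) ->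
  (forall i, (i < n)%N -> forall a b, grid 0 T n i <= a -> a <= b -> b <= grid 0 T n i.+1 -> P a b) ->
  forall a b, 0 <= a -> a <= b -> b <= T -> P a b.
Proof.
move=> T0 n0 Prefl Ptrans Pcell a b a0 ab bT.
have [g0 gn gS] := grid_partition _ _ _ (ltW T0) n0.
pose q i := Num.max a (Num.min b (grid 0 T n i)).
have aq i : a <= q i by rewrite le_max lexx.
have qb i : q i <= b by rewrite ge_max ab ge_min lexx.
have q0 : q 0%N = a by apply/max_idPl; rewrite g0 ge_min a0 orbT.
have qn : q n = b by rewrite /q gn (min_idPl bT); exact/max_idPr.
suff : forall i, (i <= n)%N -> P a (q i) by move=> /(_ n (leqnn n)); rewrite qn.
elim=> [_|i ih iN]; first by rewrite q0; apply: Prefl; rewrite a0 (le_trans ab).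
have qS : q i <= q i.+1.
  by rewrite ge_max le_max lexx /= le_max le_min !ge_min lexx /= gS// !orbT.
apply: (Ptrans a (q i)) => //; [exact: le_trans bT|exact/ih/ltnW|].
have qT : 0 <= q i <= T by rewrite (le_trans a0)//= (le_trans (qb i)).
have [bg|gb] := leP b (grid 0 T n i).
  have E j : b <= grid 0 T n j -> q j = b by move=> h; rewrite /q (min_idPl h); exact/max_idPr.
  by rewrite (E i bg) (E i.+1 (le_trans bg (gS i iN))); apply: Prefl; rewrite (le_trans a0 ab).
have [ga|ag] := leP (grid 0 T n i.+1) a.
  have E j : grid 0 T n j <= a -> q j = a.
    by move=> h; apply/max_idPl; rewrite ge_min h orbT.
  by rewrite (E i (le_trans (gS i iN) ga)) (E i.+1 ga); apply: Prefl; rewrite a0 (le_trans ab bT).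
apply: (Pcell i) => //.
  by rewrite le_max le_min lexx (ltW gb) orbT.
by rewrite ge_max (ltW ag) ge_min lexx orbT.
Qed.

(** On each cell of a grid, the slope of [k] is a value of [A] at a point that
    is [delta]-close to the path [x0 + m - k], which plays the part of [x]. *)
Definition euler T (delta : R) (x0 : H) m k := exists n (xi eta : nat -> H),
  [/\ (0 < n)%N, k 0 = 0, forall i, (i < n)%N -> A (xi i, eta i) &
   forall i, (i < n)%N -> forall t, grid 0 T n i <= t <= grid 0 T n i.+1 ->
     k t = k (grid 0 T n i) + (t - grid 0 T n i) *: eta i /\
     `|x0 + m t - k t - xi i| <= delta].

Lemma finite_norm_bound n (eta : nat -> H) :
  exists2 L, 0 <= L & forall i, (i < n)%N -> `|eta i| <= L.
Proof.
elim: n => [|n [L L0 h]]; first by exists 0.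
exists (L + `|eta n|); first by rewrite addr_ge0.
move=> i; rewrite ltnS leq_eqVlt => /predU1P[->|/h]; first by rewrite lerDr.
by move/le_trans; apply; rewrite lerDl.
Qed.

Lemma euler_incr T k n (eta : nat -> H) i :
  (forall t, grid 0 T n i <= t <= grid 0 T n i.+1 ->
     k t = k (grid 0 T n i) + (t - grid 0 T n i) *: eta i) ->
  forall a b, grid 0 T n i <= a -> a <= b -> b <= grid 0 T n i.+1 ->
    k b - k a = (b - a) *: eta i.
Proof.
move=> h a b ga ab bg; rewrite (h a) ?ga ?(le_trans ab bg)//.
rewrite (h b) ?bg ?(le_trans ga ab)//; apply: (dot_ext dot norm_dot) => v.
by rewrite !dotE; ring.
Qed.

Lemma lipschitz_ctrl T (L : R) k :
  (forall a b, 0 <= a -> a <= b -> b <= T -> `|k b - k a| <= L * (b - a)) ->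
  ctrl 0 T k (fun t => L * t).
Proof. by move=> h a b a0 ab bT; rewrite -mulrBr; exact: h. Qed.

Lemma lipschitz_ucont T (L : R) k : 0 <= L ->
  (forall a b, 0 <= a -> a <= b -> b <= T -> `|k b - k a| <= L * (b - a)) ->
  ucont 0 T k.
Proof.
move=> L0 h e e0; have L1 : 0 < L + 1 by lra.
exists (e / (L + 1)); first by rewrite divr_gt0.
move=> s t; wlog st : s t / s <= t => [W sT tT|/andP[s0 sT] /andP[t0 tT]].
  have [/W|/ltW /W] := leP s t; first exact.
  by rewrite (distrC s) (distrC (k s)); exact.
rewrite distrC ger0_norm ?subr_ge0// ltr_pdivlMr// => d.
rewrite distrC (le_lt_trans (h s t _ _ _))// (le_lt_trans _ d)// mulrC ler_wpM2l ?subr_ge0//.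
by rewrite lerDl.
Qed.

Lemma euler_lipschitz T d x0 m k : 0 < T -> euler T d x0 m k ->
  exists2 L, 0 <= L & forall a b, 0 <= a -> a <= b -> b <= T -> `|k b - k a| <= L * (b - a).
Proof.
move=> T0 [n [xi [eta [n0 _ _ h]]]]; have [L L0 hL] := finite_norm_bound n eta.
exists L => //; apply: (cell_chain T n) => // [a _|a b c a0 ab bc cT h1 h2|i iN a b ga ab bg].
- by rewrite !subrr normr0 mulr0.
- rewrite -[k c](subrK (k b)) -addrA (le_trans (ler_normD _ _))//.
  by apply: (le_trans (lerD h2 h1)); lra.
- rewrite (euler_incr T k n eta i)// => [|t /(h i iN)[]//].
  by rewrite normrZ ger0_norm ?subr_ge0// mulrC ler_wpM2r ?subr_ge0// hL.
Qed.

(** If [x] is replaced by [xi i] on the cell, the integrand becomes the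
    nonnegative number [<xi i - z, eta i - zs>]. *)
Lemma euler_aGSP T d x0 m k : 0 < T -> 0 <= d -> ucont 0 T m -> euler T d x0 m k ->
  aGSP dot A T d x0 m (fun t => x0 + m t - k t) k.
Proof.
move=> T0 d0 mc E; have [L L0 lip] := euler_lipschitz _ _ _ _ _ T0 E.
have ku := lipschitz_ucont _ _ _ L0 lip; have kc := lipschitz_ctrl _ _ _ lip.
have bv : var_le 0 T k (L * T - L * 0) by exact: ctrl_var_le.
have vc := varf_ctrl _ _ _ bv.
have xu : ucont 0 T (fun t => x0 + m t - k t).
  by apply: ucontB => //; apply: ucontD => //; exact: ucont_cst.
case: E => n [xi [eta [n0 k0 Axi h]]].
split => //; [by exists (L * T - L * 0)|by move=> t _; rewrite subrK|].
move=> z zs Az.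
have rs : rsable 0 T (fun r => x0 + m r - k r - z) (fun r => k r - r *: zs).
  split; first by apply: ucontB => //; exact: ucont_cst.
  by exists (fun r => L * r + r * `|zs|); apply: ctrlB => //; exact: ctrl_lin.
apply: (cell_chain T n) => // [a /andP[a0 aT]|a b c a0 ab bc cT h1 h2|i iN a b ga ab bg].
- by rewrite RS_refl ?subrr ?mulr0 ?addr0 ?mulr0 ?oppr0//; exact: rsableW rs.
- rewrite (RS_split dot norm_dot a b c)//; last exact: rsableW rs.
  by apply: le_trans (lerD h1 h2); lra.
have P := grid_partition _ _ _ (ltW T0) n0.
have /andP[gi0 _] := partition_in _ _ _ _ _ P (ltnW iN).
have /andP[_ giT] := partition_in _ _ _ _ _ P iN.
have a0 := le_trans gi0 ga; have bT := le_trans bg giT.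
have incr s t : a <= s -> s <= t -> t <= b -> k t - k s = (t - s) *: eta i.
  move=> as_ st tb; apply: (euler_incr T k n eta i); [by move=> r /(h i iN)[]|
    exact: le_trans as_|by []|exact: le_trans bg].
have hx r : a <= r <= b -> `|x0 + m r - k r - xi i| <= d.
  by move=> /andP[ar rb]; apply: (h i iN r _).2; rewrite (le_trans ga ar) (le_trans rb bg).
have lin (v : H) : ctrl a b (fun r => r *: v) (fun r => r * `|v|) by exact: ctrl_lin.
have xu' (v : H) : ucont a b (fun r => x0 + m r - k r - v).
  by apply: (ucontW 0 T) => //; apply: ucontB => //; exact: ucont_cst.
have -> : RS dot a b (fun r => x0 + m r - k r - z) (fun r => k r - r *: zs) =
    RS dot a b (fun r => x0 + m r - k r - xi i) (fun r => r *: (eta i - zs)) +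
    RS dot a b (fun=> xi i - z) (fun r => r *: (eta i - zs)).
  rewrite -RSDl//; [|by split; [|exists (fun r => r * `|eta i - zs|)]|
    by split; [exact: ucont_cst|exists (fun r => r * `|eta i - zs|)]].
  apply: (RS_ext dot norm_dot) => //.
  - split; last by exists (fun r => r * `|eta i - zs|).
    by apply: ucontD => //; exact: ucont_cst.
  - by move=> r _; rewrite addrA subrK.
  - move=> s t as_ st tb; rewrite opprB addrACA addrAC addrA.
    have := incr s t as_ st tb => E; apply: (dot_ext dot norm_dot) => v.
    have : dot (k t - k s) v = dot ((t - s) *: eta i) v by rewrite E.
    by rewrite !dotE; lra.
rewrite RS_cst// -scalerBl dotZr.
have h1 : 0 <= (b - a) * dot (xi i - z) (eta i - zs).
  by rewrite mulr_ge0 ?subr_ge0//; exact: (Amon _ _ (Axi i iN) Az).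
have := RS_bound dot norm_dot _ _ _ _ _ _ ab (xu' (xi i)) (lin (eta i - zs)) hx.
rewrite -mulrBl ler_norml => /andP[h2 _].
have h3 : d * ((b - a) * `|eta i - zs|) <= d * (varf k b - varf k a + `|zs| * (b - a)).
  rewrite ler_wpM2l//; apply: (@le_trans _ _ ((b - a) * (`|eta i| + `|zs|))).
    by rewrite ler_wpM2l ?subr_ge0// ler_normB.
  rewrite mulrDr [X in _ + X]mulrC lerD2r.
  have := vc a b a0 ab bT; rewrite incr// normrZ ger0_norm ?subr_ge0//.
by move: h1 h2 h3; set q1 := RS _ _ _ _ _; lra.
Qed.

(** On each cell the inequality of the approximate solution is tested at the
    point [(xi i, eta i)] of the graph; this bounds from below the integral of
    [<x - X, d(k - K)>], where [X = x0' + m' - K].  The chain rule for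
    [|x - X - (m - m')|^2] concludes.  Testing against an approximation, not
    against a second solution, is what gives access to elements of the
    graph. *)
Lemma comparison T d d' x0 x0' m m' (x : R -> H) k K (theta : R) : 0 < T -> 0 <= d -> 0 <= d' ->
  aGSP dot A T d x0 m x k -> ucont 0 T m' -> euler T d' x0' m' K ->
  (forall t, 0 <= t <= T -> `|m t - m' t| <= theta) ->
  forall t, 0 <= t <= T ->
  `|(x t - (x0' + m' t - K t)) - (m t - m' t)| ^+ 2 <=
  `|x0 - x0'| ^+ 2 + 2 * (theta + d + d') * (varf k T + varf K T).
Proof.
move=> T0 d0 d'0 X m'c E mth t /andP[t0 tT].
have Y := euler_aGSP _ _ _ _ _ T0 d'0 m'c E.
have kc := aGSP_ctrl _ _ _ _ _ _ _ _ X; have Kc := aGSP_ctrl _ _ _ _ _ _ _ _ Y.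
have xu := aGSP_x _ _ _ _ _ _ _ _ X; have Xu := aGSP_x _ _ _ _ _ _ _ _ Y.
have ku := aGSP_k _ _ _ _ _ _ _ _ X; have Ku := aGSP_k _ _ _ _ _ _ _ _ Y.
have mc := aGSP_m _ _ _ _ _ _ _ _ X.
have vv : ctrl 0 T (fun r => k r - K r) (fun r => varf k r + varf K r) by exact: ctrlB.
set XX := fun r => x0' + m' r - K r in Y Xu *.
have rs f : ucont 0 T f -> rsable 0 T f (fun r => k r - K r).
  by move=> fu; split => //; exists (fun r => varf k r + varf K r).
have xXu : ucont 0 T (fun r => x r - XX r) by exact: ucontB.
have mono : forall a b, 0 <= a -> a <= b -> b <= T ->
    - ((d + d') * (varf k b - varf k a + (varf K b - varf K a))) <=
    RS dot a b (fun r => x r - XX r) (fun r => k r - K r).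
  case: E => n [xi [eta [n0 K0 Axi h]]].
  apply: (cell_chain T n) => // [a /andP[a0 aT]|a b c a0 ab bc cT h1 h2|i iN a b ga ab bg].
  - rewrite RS_refl ?subrr ?addr0 ?mulr0 ?oppr0//; apply: rsableW (rs _ xXu) => //.
  - rewrite (RS_split dot norm_dot a b c)//; last by apply: rsableW (rs _ xXu).
    by apply: le_trans (lerD h1 h2); lra.
  have P := grid_partition _ _ _ (ltW T0) n0.
  have /andP[gi0 _] := partition_in _ _ _ _ _ P (ltnW iN).
  have /andP[_ giT] := partition_in _ _ _ _ _ P iN.
  have a0 := le_trans gi0 ga; have bT := le_trans bg giT.
  have incr s r : a <= s -> s <= r -> r <= b -> K r - K s = (r - s) *: eta i.
    move=> as_ sr rb; apply: (euler_incr T K n eta i); [by move=> r' /(h i iN)[]|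
      exact: le_trans as_|by []|exact: le_trans bg].
  have hx r : a <= r <= b -> `|xi i - XX r| <= d'.
    move=> /andP[ar rb]; rewrite distrC; apply: (h i iN r _).2.
    by rewrite (le_trans ga ar) (le_trans rb bg).
  have xiu : ucont a b (fun r => xi i - XX r).
    by apply: (ucontW 0 T) => //; apply: ucontB => //; exact: ucont_cst.
  have xu' : ucont a b (fun r => x r - xi i).
    by apply: (ucontW 0 T) => //; apply: ucontB => //; exact: ucont_cst.
  have vvab : ctrl a b (fun r => k r - K r) (fun r => varf k r + varf K r) by exact: (ctrlW 0 T).
  have rsab f : ucont a b f -> rsable a b f (fun r => k r - K r).
    by move=> fu; split => //; exists (fun r => varf k r + varf K r).
  have -> : RS dot a b (fun r => x r - XX r) (fun r => k r - K r) =
      RS dot a b (fun r => x r - xi i) (fun r => k r - K r) +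
      RS dot a b (fun r => xi i - XX r) (fun r => k r - K r).
    rewrite -RSDl//; [|exact: rsab|exact: rsab].
    apply: (RS_ext dot norm_dot) => //; first by apply: rsab; exact: ucontD.
    by move=> r _; rewrite addrA subrK.
  have -> : RS dot a b (fun r => x r - xi i) (fun r => k r - K r) =
      RS dot a b (fun r => x r - xi i) (fun r => k r - r *: eta i).
    apply: (RS_ext dot norm_dot) => //.
      by apply: (rsableW 0 T) => //; exact: aGSP_rsable X.
    move=> s r as_ sr rb; apply: (dot_ext dot norm_dot) => v.
    have : dot (K r - K s) v = dot ((r - s) *: eta i) v by rewrite incr.
    by rewrite !dotE; lra.
  have h1 := aGSP_ineq _ _ _ _ _ _ _ _ X _ _ (Axi i iN) a b a0 ab bT.
  have h2 := RS_bound dot norm_dot _ _ _ _ _ _ ab xiu vvab hx.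
  have h3 : `|eta i| * (b - a) <= varf K b - varf K a.
    by have := Kc a b a0 ab bT; rewrite incr// normrZ ger0_norm ?subr_ge0// mulrC.
  have h4 : d * (`|eta i| * (b - a)) <= d * (varf K b - varf K a) by rewrite ler_wpM2l.
  move: h2; rewrite ler_norml => /andP[h2 _]; move: h1 h2 h4.
  by set q1 := RS _ _ _ _ _; set q2 := RS _ _ _ _ _; lra.
have {}mono := mono 0 t (lexx 0) t0 tT.
pose y r := (x r - XX r) - (m r - m' r).
have inT r : 0 <= r <= t -> 0 <= r <= T by move=> /andP[-> h2]; rewrite (le_trans h2 tT).
have yE r : 0 <= r <= t -> y r = (x0 - x0') - (k r - K r).
  move=> /inT /(aGSP_eq _ _ _ _ _ _ _ _ X) E1; apply: (dot_ext dot norm_dot) => v.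
  have : dot (x r + k r) v = dot (x0 + m r) v by rewrite E1.
  by rewrite /y /XX !dotE; lra.
have y0 : y 0 = x0 - x0'.
  rewrite yE ?lexx// (aGSP_k0 _ _ _ _ _ _ _ _ X) (aGSP_k0 _ _ _ _ _ _ _ _ Y).
  by rewrite !subr0.
have mu : ucont 0 T (fun r => m r - m' r) by exact: ucontB.
have yu : ucont 0 T y by exact: ucontB.
have incr s r : 0 <= s -> s <= r -> r <= t -> y r - y s = - (k r - K r) - - (k s - K s).
  move=> s0 sr rt; rewrite !yE ?s0 ?(le_trans sr)// ?(le_trans s0)//.
  by apply: (dot_ext dot norm_dot) => v; rewrite !dotE; ring.
have vt := ctrlW _ _ _ _ _ _ (lexx 0) tT vv.
have rst f : ucont 0 T f -> rsable 0 t f (fun r => k r - K r).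
  by move=> fu; apply: rsableW (rs _ fu).
have yy : rsable 0 t y y.
  split; first exact: (ucontW 0 T).
  exists (fun r => varf k r + varf K r) => s r s0 sr rt; rewrite incr//.
  exact: (ctrlN _ _ _ _ vt).
have S : 2 * RS dot 0 t y y = `|y t| ^+ 2 - `|x0 - x0'| ^+ 2 by rewrite RS_sqr// y0.
have S1 : RS dot 0 t y y = - (RS dot 0 t (fun r => x r - XX r) (fun r => k r - K r) -
    RS dot 0 t (fun r => m r - m' r) (fun r => k r - K r)).
  rewrite -RSBl//; [|exact: rst|exact: rst].
  rewrite -RSNr//; last exact: rst.
  apply: (RS_ext dot norm_dot) => //; split; first exact: (ucontW 0 T).
  by exists (fun r => varf k r + varf K r); exact: ctrlN.
have h := RS_bound dot norm_dot _ _ _ _ _ theta t0 (ucontW _ _ _ _ _ (lexx 0) tT mu) vt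
  (fun r rt => mth r (inT r rt)).
rewrite -/(XX t) -/(y t).
have vm := ctrl_mono _ _ _ _ _ _ kc t0 tT (lexx T).
have Vm := ctrl_mono _ _ _ _ _ _ Kc t0 tT (lexx T).
have th0 : 0 <= theta by rewrite (le_trans (normr_ge0 (m 0 - m' 0)))// mth// lexx ltW.
move: h mono S; rewrite S1 !varf0 !subr0 addr0 subr0 ler_norml => /andP[_ h] mono S.
have h5 : (theta + d + d') * (varf k t + varf K t) <= (theta + d + d') * (varf k T + varf K T).
  by rewrite ler_wpM2l ?addr_ge0// lerD.
by move: h mono S h5; set q1 := RS _ _ _ _ _; set q2 := RS _ _ _ _ _; lra.
Qed.

End euler_approximations.

(** * The Euler scheme *)

Section euler_scheme.
Context {R : realType} {H : completeNormedModType R} (dot : {dot H for idfun})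
  (norm_dot : forall u : H, `|u| ^+ 2 = dot u u) (A : set (H * H))
  (A_max : maximal_monotone dot A).
Implicit Types (T : R) (m k : R -> H) (n p : nat).

Lemma nonexpansive (h : R) (z zs w ws : H) : 0 < h -> A (z, zs) -> A (w, ws) ->
  `|z - w| <= `|(z + h *: zs) - (w + h *: ws)|.
Proof.
move=> h0 Az Aw; rewrite -(@ler_pXn2r _ 2)// ?nnegrE// !norm_dot.
have -> : z + h *: zs - (w + h *: ws) = (z - w) + h *: (zs - ws).
  by apply: (dot_ext dot norm_dot) => v; rewrite !dotE; ring.
have := A_max.1 _ _ Az Aw => /=; move: (z - w) (zs - ws) => a b ab.
have h1 : 0 <= h * dot a b by rewrite mulr_ge0// ltW.
have h2 : 0 <= h * h * dot b b by rewrite mulr_ge0 ?dot_ge0// mulr_ge0// ltW.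
by move: h1 h2; rewrite !dotE (dotC dot b a); lra.
Qed.

(** [t] clamped to [[s, s + h]] and measured from [s]. *)
Definition clamp (h s t : R) : R := Num.max 0 (Num.min (t - s) h).

Lemma clamp_left h s t : t <= s -> clamp h s t = 0.
Proof. by move=> ts; apply/max_idPl; rewrite ge_min subr_le0 ts. Qed.

Lemma clamp_right h s t : 0 <= h -> s + h <= t -> clamp h s t = h.
Proof.
by move=> h0 st; rewrite /clamp (min_idPr _) ?lerBrDl//; exact/max_idPr.
Qed.

Lemma clamp_in h s t : s <= t -> t <= s + h -> clamp h s t = t - s.
Proof.
move=> st th; rewrite /clamp (min_idPl _) ?lerBlDl//.
by apply/max_idPr; rewrite subr_ge0.
Qed.

Lemma grid_le T n i j : 0 <= T -> (i <= j)%N -> grid 0 T n i <= grid 0 T n j.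
Proof.
by move=> T0 ij; rewrite lerD2l ler_wpM2r ?subr0 ?divr_ge0// ler_nat.
Qed.

Lemma gridM T n p i : (0 < p)%N -> grid 0 T (n * p) (i * p) = grid 0 T n i.
Proof.
move=> p0; rewrite /grid !natrM subr0 -!mulrA invfM; congr (_ + _ * _).
by rewrite mulrCA [X in _ * X]mulrCA divff ?mulr1// pnatr_eq0 -lt0n.
Qed.

(** A closed form of the primitive of the step function with values [eta i]. *)
Definition polygon T n (eta : nat -> H) (t : R) : H :=
  \sum_(j < n) clamp (T / n%:R) (grid 0 T n j) t *: eta j.

Lemma polygon0 T n eta : 0 <= T -> polygon T n eta 0 = 0.
Proof.
move=> T0; apply: big1 => j _; rewrite clamp_left ?scale0r//.
by rewrite -[leLHS](grid0 0 T n) grid_le.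
Qed.

Lemma polygonE T n eta i t : 0 <= T -> (i < n)%N ->
  grid 0 T n i <= t <= grid 0 T n i.+1 ->
  polygon T n eta t = polygon T n eta (grid 0 T n i) + (t - grid 0 T n i) *: eta i.
Proof.
move=> T0 ni /andP[it ti]; apply/eqP; rewrite addrC -subr_eq -sumrB.
have h0 : 0 <= T / n%:R by rewrite divr_ge0.
have gS j : grid 0 T n j + T / n%:R = grid 0 T n j.+1 by rewrite gridS subr0.
rewrite (bigD1 (Ordinal ni))//= big1 ?addr0 => [|j ji].
  rewrite (clamp_in _ _ t)// ?gS// (clamp_left _ _ (grid 0 T n i))//.
  by rewrite scale0r subr0.
have [lt_ji|lt_ij|eq_ji] := ltngtP j i; last by move: ji; rewrite -val_eqE /= eq_ji eqxx.
  have h1 : grid 0 T n j.+1 <= grid 0 T n i by exact: grid_le.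
  by rewrite !clamp_right ?subrr// gS// (le_trans h1).
have h1 : grid 0 T n i.+1 <= grid 0 T n j by exact: grid_le.
have h2 := le_trans ti h1.
by rewrite !clamp_left ?subrr// (le_trans it).
Qed.

(** The implicit Euler scheme, driven by the piecewise linear interpolation of
    [m] on a coarse grid of [N] cells, each divided into [p] steps.  The
    resolvent being nonexpansive, the increments of the scheme only grow when
    the slope of the interpolation changes, that is [N] times; hence they tend
    to [0] as [p] grows.  This is why the start [x0] has to lie in the domain: the
    first increment is of order [h |eta0|]. *)
Lemma euler_exists T x0 m (e : R) : 0 < T -> Dom A x0 -> ucont 0 T m -> m 0 = 0 ->
  0 < e -> exists K, euler A T e x0 m K.
Proof.
move=> T0 [eta0 A0] mc m0 e_gt0.
(* on a cell, five errors of size [e / 8] add up *)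
pose e8 := e / 8; have e80 : 0 < e8 by rewrite divr_gt0.
have [d d0 md] := mc _ e80.
have [N N0 /(_ m erefl) oscm] := osc_grid T [set m] d e8 T0 d0 ltac:(by move=> _ ->).
pose G := grid 0 T N; have G0 : G 0%N = 0 by exact: grid0.
pose D j := m (G j.+1) - m (G j).
have De j : (j < N)%N -> `|D j| <= e8.
  by move=> jN; apply: oscm => //; rewrite lexx andbT grid_le// ltW.
pose C := T * `|eta0| / N%:R + (2 * N%:R + 1) * e8.
have [p p0 pC] := small_step 0 C _ e80; rewrite subr0 in pC.
have pR : 0 < p%:R :> R by rewrite ltr0n.
pose n := (N * p)%N; have n0 : (0 < n)%N by rewrite muln_gt0 N0.
pose h := T / n%:R; have h0 : 0 < h by rewrite divr_gt0// ltr0n.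
have divN i : (i < n)%N -> (i %/ p < N)%N by move=> ni; rewrite ltn_divLR.
pose delta i := p%:R^-1 *: D (i %/ p)%N.
have deltae i : (i < n)%N -> `|delta i| <= e8 / p%:R.
  by move=> /divN/De h1; rewrite normrZ gtr0_norm ?invr_gt0// mulrC ler_pM2r ?invr_gt0.
have /choice[J hJ] y : exists z : H * H, A z /\ z.1 + h *: z.2 = y.
  by have [z [zs [Az E]]] := resolvent dot norm_dot A h y A_max h0; exists (z, zs).
pose fix s i := if i is j.+1 then J ((s j).1 + delta j) else (x0, eta0).
have As i : A (s i).
  by case: i => [//|i]; exact: (hJ _).1.
have sE i : (s i.+1).1 + h *: (s i.+1).2 = (s i).1 + delta i by exact: (hJ _).2.
have ne i j : `|(s i).1 - (s j).1| <= `|((s i).1 + h *: (s i).2) - ((s j).1 + h *: (s j).2)|.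
  by apply: nonexpansive => //; rewrite -surjective_pairing; exact: As.
have incr i : (i < n)%N -> `|(s i.+1).1 - (s i).1| <=
    h * `|eta0| + (2 * (i %/ p)%:R + 1) * (e8 / p%:R).
  elim: i => [_|i ih iN].
    rewrite div0n mulr0 add0r mul1r (le_trans (ne _ _))// sE /=.
    rewrite opprD addrACA subrr add0r (le_trans (ler_normB _ _))// addrC lerD//.
      by rewrite normrZ gtr0_norm.
    exact: deltae.
  apply: (le_trans (ne _ _)); rewrite !sE opprD addrACA.
  apply: (le_trans (ler_normD _ _)).
  have := ih (ltnW iN); have := deltae _ iN; have := deltae _ (ltnW iN).
  have [E|E] := eqVneq (i.+1 %/ p)%N (i %/ p)%N.
    by rewrite /delta E subrr normr0 => _ _; rewrite addr0.
  have -> : (i.+1 %/ p)%N = (i %/ p).+1.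
    by move: E; rewrite divnS//; case: (p %| i.+1)%N; rewrite ?add1n ?eqxx.
  have := ler_normB (delta i.+1) (delta i); rewrite -natr1.
  by set q := e8 / p%:R; lra.
have incr8 i : (i < n)%N -> `|(s i.+1).1 - (s i).1| <= e8.
  move=> ni; apply: le_trans (incr i ni) (le_trans _ (ltW pC)).
  rewrite /C [leRHS]mulrDl lerD//.
    suff -> : h * `|eta0| = T * `|eta0| / N%:R / p%:R by [].
    by rewrite /h /n natrM invfM; ring.
  rewrite -[leRHS]mulrA ler_wpM2r ?(ltW (divr_gt0 e80 pR))//.
  by rewrite lerD2r ler_wpM2l// ler_nat ltnW// divN.
pose eta i := (s i.+1).2; pose K := polygon T n eta.
have KS i t : (i < n)%N -> grid 0 T n i <= t <= grid 0 T n i.+1 ->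
    K t = K (grid 0 T n i) + (t - grid 0 T n i) *: eta i.
  by move=> ni it; apply: polygonE => //; exact: ltW.
have gS i : grid 0 T n i.+1 = grid 0 T n i + h by rewrite gridS subr0.
(* the scheme reproduces the interpolation of [m] exactly at the grid points *)
have mu i : (i <= n)%N -> (s i).1 + K (grid 0 T n i) =
    x0 + m (G (i %/ p)%N) + ((i %% p)%:R / p%:R) *: D (i %/ p)%N.
  elim: i => [_|i ih iN].
    by rewrite div0n mod0n mul0r scale0r addr0 G0 m0 grid0 /K polygon0// ltW.
  have step : (s i.+1).1 + K (grid 0 T n i.+1) = (s i).1 + K (grid 0 T n i) + delta i.
    rewrite (KS i)//; last by rewrite lexx andbT grid_le// ltW.
    rewrite gS [X in X *: _]addrAC subrr add0r addrCA sE.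
    by rewrite addrA [K _ + _]addrC.
  rewrite step ih ?(ltnW iN)// /delta divnS// modnS.
  have [pi|npi] := boolP (p %| i.+1)%N; last first.
    by rewrite add0n -addrA -scalerDl -natr1 mulrDl mul1r.
  rewrite add1n mul0r scale0r addr0 -addrA -scalerDl.
  have ip : (i %% p).+1 = p.
    have := ltn_pmod i p0; rewrite leq_eqVlt => /predU1P[//|lt_ip].
    move: pi; rewrite {1}(divn_eq i p) -addnS dvdn_addr ?dvdn_mull// => /dvdn_leq.
    by move=> /(_ isT); rewrite leqNgt lt_ip.
  have -> : (i %% p)%:R / p%:R + p%:R^-1 = 1 :> R.
    by rewrite -[X in _ + X]mul1r -mulrDl natr1 ip divff// gt_eqF.
  by rewrite scale1r; apply: (dot_ext dot norm_dot) => v; rewrite !(dotDl, dotNl); ring.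
exists K; exists n, (fun i => (s i.+1).1), eta; split => //.
- by rewrite /K polygon0// ltW.
- by move=> i _; rewrite -surjective_pairing; exact: As.
move=> i ni t it; have KE := KS i t ni it; split => //.
have iN := divN _ ni; set q := (i %/ p)%N in iN.
have mt : `|m t - m (G q)| <= e8.
  apply: oscm => //; have /andP[h1 h2] := it; apply/andP; split.
    by apply: le_trans h1; rewrite -(gridM T N p)// grid_le ?leq_divM ?ltW.
  by apply: le_trans h2 _; rewrite -(gridM T N p)// grid_le ?(ltW T0)// ltn_ceil.
have hd : `|h *: eta i| <= e8 + e8.
  have -> : h *: eta i = delta i - ((s i.+1).1 - (s i).1).
    rewrite -(addKr (s i).1 (delta i)) -sE -/(eta i); apply: (dot_ext dot norm_dot) => v.
    by rewrite !(dotDl, dotNl); ring.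
  rewrite (le_trans (ler_normB _ _))// lerD ?incr8// (le_trans (deltae i ni))//.
  by rewrite ler_pdivrMr// -[leLHS]mulr1 ler_pM2l// ler1n.
have hd' : `|(t - grid 0 T n i) *: eta i| <= e8 + e8.
  apply: le_trans hd; rewrite [leLHS]normrZ [leRHS]normrZ ler_wpM2r//.
  have /andP[h1 h2] := it; rewrite ger0_norm ?subr_ge0// (gtr0_norm h0).
  by rewrite lerBlDl; apply: le_trans h2 _; rewrite gS.
have hq : `|((i %% p)%:R / p%:R) *: D q| <= e8.
  rewrite normrZ ger0_norm ?divr_ge0//; apply: le_trans (De q iN).
  by rewrite ler_piMl// ler_pdivrMr// mul1r ler_nat ltnW// ltn_pmod.
rewrite (_ : x0 + m t - K t - (s i.+1).1 = (m t - m (G q)) - ((i %% p)%:R / p%:R) *: D q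
    - ((s i.+1).1 - (s i).1) - (t - grid 0 T n i) *: eta i); last first.
  have := mu i (ltnW ni); rewrite -/q KE => E; apply: (dot_ext dot norm_dot) => v.
  have : dot ((s i).1 + K (grid 0 T n i)) v =
      dot (x0 + m (G q) + ((i %% p)%:R / p%:R) *: D q) v by rewrite E.
  by rewrite !(dotDl, dotNl); lra.
move: (incr8 i ni) mt hq hd'; move: (_ - _) (_ *: _) (_ - _) (_ *: _) => a b c w.
have := ler_normB (a - w - c) b; have := ler_normB (a - w) c; have := ler_normB a w.
rewrite /e8; lra.
Qed.

End euler_scheme.

(** * Limits of approximate solutions *)

Section limits.
Context {R : realType} {H : completeNormedModType R} (dot : {dot H for idfun})
  (norm_dot : forall u : H, `|u| ^+ 2 = dot u u) (A : set (H * H)).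
Implicit Types (a b c T : R) (f g m k : R -> H) (w : R -> R) (n : nat).

Lemma le_of_small (u v c e0 : R) : 0 < e0 ->
  (forall e, 0 < e -> e <= e0 -> u <= v + c * e) -> u <= v.
Proof.
move=> e00 h; apply/ler_addgt0Pr => e e_gt0.
have c1 : 0 < `|c| + 1 by rewrite ltr_wpDl.
pose d := Num.min e0 (e / (`|c| + 1)).
have d0 : 0 < d by rewrite lt_min e00 divr_gt0.
apply: le_trans (h d d0 _) _; first by rewrite ge_min lexx.
rewrite lerD2l; apply: (@le_trans _ _ ((`|c| + 1) * d)).
  by rewrite ler_wpM2r ?(ltW d0)// (le_trans (ler_norm c))// lerDl.
by rewrite mulrC -ler_pdivlMr// ge_min lexx orbT.
Qed.

Lemma ucont_limit a b f :
  (forall e, 0 < e -> exists2 f', ucont a b f' & forall t, a <= t <= b -> `|f t - f' t| <= e) ->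
  ucont a b f.
Proof.
move=> h e e0; have e3 : 0 < e / 3 by rewrite divr_gt0.
have [f' f'c ff'] := h _ e3; have [d d0 hd] := f'c _ e3.
exists d => // s t sab tab st.
have -> : f s - f t = (f s - f' s) + (f' s - f' t) - (f t - f' t).
  by rewrite subrKA opprB addrA subrK.
have := ler_normB ((f s - f' s) + (f' s - f' t)) (f t - f' t).
have := ler_normD (f s - f' s) (f' s - f' t).
have := ff' s sab; have := ff' t tab; have := hd s t sab tab st; lra.
Qed.

(** The integral against a uniformly small integrator of controlled
    variation is small: [f] is replaced by a step function. *)
Lemma RS_small a b f (e : R) : a <= b -> ucont a b f -> 0 < e -> exists2 C, 0 <= C &
  forall g w (V d : R), ctrl a b g w -> w b - w a <= V ->
    (forall r, a <= r <= b -> `|g r| <= d) -> `|RS dot a b f g| <= e * V + C * d.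
Proof.
move=> ab fc e0; have [q qd hq] := fc _ e0.
have [N N0 Nq] := small_step a b _ qd.
have [cmax _ fM] := ucont_max _ _ _ ab fc; set F := `|f cmax| in fM.
exists (N%:R * (F * 2)); first by rewrite !mulr_ge0// /F.
move=> g w V d gw wV gd.
have P := grid_partition _ _ _ ab N0; have [g0 gN gS] := P.
set p := grid a b N in g0 gN gS P.
have pin i : (i <= N)%N -> a <= p i <= b by exact: partition_in P.
have fg : rsable a b f g by split => //; exists w.
have -> : RS dot a b f g = \sum_(0 <= i < N) RS dot (p i) (p i.+1) f g.
  by rewrite -{1}g0 -{1}gN; apply: (RS_chain dot norm_dot) => //; rewrite g0 gN.
apply: (le_trans (ler_norm_sum _ _ _)).
have wS : \sum_(0 <= i < N) (w (p i.+1) - w (p i)) <= V.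
  by rewrite (telescope_sumr (fun i => w (p i)))// g0 gN.
have e' := ltW e0.
apply: (@le_trans _ _ (e * (\sum_(0 <= i < N) (w (p i.+1) - w (p i))) + N%:R * (F * 2) * d));
  last by rewrite lerD2r ler_wpM2l.
have -> : N%:R * (F * 2) * d = \sum_(0 <= i < N) F * 2 * d.
  by rewrite sumr_const_nat subn0 -mulrA mulr_natl.
rewrite mulr_sumr -big_split; apply: ler_sum_nat => i /= iN.
have /andP[ai ib] := pin i (ltnW iN); have /andP[ai' ib'] := pin i.+1 iN.
have pp : p i <= p i.+1 by exact: gS.
have fu : ucont (p i) (p i.+1) f by exact: ucontW fc.
have gc : ctrl (p i) (p i.+1) g w by exact: ctrlW gw.
have fu' : ucont (p i) (p i.+1) (fun r => f r - f (p i)) by apply: ucontB => //; exact: ucont_cst.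
have -> : RS dot (p i) (p i.+1) f g = RS dot (p i) (p i.+1) (fun r => f r - f (p i)) g +
    RS dot (p i) (p i.+1) (fun=> f (p i)) g.
  rewrite -RSDl//; [|by split => //; exists w|by split; [exact: ucont_cst|exists w]].
  apply: (RS_ext dot norm_dot) => // [|r _]; last by rewrite subrK.
  by split; [apply: ucontD => //; exact: ucont_cst|exists w].
rewrite (le_trans (ler_normD _ _))// lerD//.
  apply: (RS_bound dot norm_dot) => // r /andP[pr rp]; apply/ltW/hq.
  - by rewrite (le_trans ai pr) (le_trans rp ib').
  - by rewrite ai ib.
  rewrite ger0_norm ?subr_ge0// (le_lt_trans _ Nq)// lerBlDl.
  by rewrite -gridS.
rewrite RS_cst// (le_trans (normr_dot_le _ norm_dot _ _))// -mulrA ler_pM//.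
  by apply: fM; rewrite ai.
have := ler_normB (g (p i.+1)) (g (p i)); have := gd (p i) (pin i (ltnW iN)).
have := gd (p i.+1) (pin i.+1 iN); lra.
Qed.

(** In the decomposition [E] below the three integrals are respectively almost
    nonnegative, small because [x - x'] is, and small by [RS_small]. *)
Lemma aGSP_limit T (V : R) x0 m (x : R -> H) k : 0 < T ->
  (forall e, 0 < e -> exists d x0' x' k', [/\ 0 <= d, d <= e, aGSP dot A T d x0' m x' k',
     varf k' T <= V & `|x0 - x0'| <= e /\
     forall t, 0 <= t <= T -> `|x t - x' t| <= e /\ `|k t - k' t| <= e]) ->
  aGSP dot A T 0 x0 m x k.
Proof.
move=> T0 h.
have xu : ucont 0 T x.
  apply: ucont_limit => e e0; have [d [x0' [x' [k' [_ _ X _ [_ hh]]]]]] := h e e0.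
  by exists x' => [|t /hh[]//]; exact: aGSP_x X.
have ku : ucont 0 T k.
  apply: ucont_limit => e e0; have [d [x0' [x' [k' [_ _ X _ [_ hh]]]]]] := h e e0.
  by exists k' => [|t /hh[]//]; exact: aGSP_k X.
have kV : var_le 0 T k V.
  move=> n p P; apply: (le_of_small _ _ (n%:R * 2) 1) => // e e0 _.
  have [d [x0' [x' [k' [_ _ X vV [_ hh]]]]]] := h e e0.
  have [B kB] := aGSP_bv _ _ _ _ _ _ _ _ X.
  have h1 := le_trans (vsum_varf _ _ _ _ _ (ltW T0) kB P) vV.
  apply: (le_trans _ (lerD h1 (lexx _))).
  have -> : n%:R * 2 * e = \sum_(0 <= i < n) 2 * e.
    by rewrite sumr_const_nat subn0 -mulrA mulr_natl.
  rewrite -big_split; apply: ler_sum_nat => i /= ni.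
  have [_ h2] := hh _ (partition_in _ _ _ _ _ P (ltnW ni)).
  have [_ h3] := hh _ (partition_in _ _ _ _ _ P ni).
  have -> : k (p i.+1) - k (p i) = (k' (p i.+1) - k' (p i)) +
      ((k (p i.+1) - k' (p i.+1)) - (k (p i) - k' (p i))).
    by apply: (dot_ext dot norm_dot) => v; rewrite !(dotDl, dotNl); ring.
  have := ler_normD (k' (p i.+1) - k' (p i)) ((k (p i.+1) - k' (p i.+1)) - (k (p i) - k' (p i))).
  have := ler_normB (k (p i.+1) - k' (p i.+1)) (k (p i) - k' (p i)).
  by lra.
have in0 : (0 : R) <= 0 <= T by rewrite lexx ltW.
split => //; [|by exists V| |].
- apply/eqP; rewrite -normr_le0; apply: (le_of_small _ _ 1 1) => // e e0 _.
  have [d [x0' [x' [k' [_ _ X _ [_ hh]]]]]] := h e e0.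
  have [_] := hh 0 in0; rewrite (aGSP_k0 _ _ _ _ _ _ _ _ X) subr0; lra.
- move=> t tT; apply/subr0_eq/eqP; rewrite -normr_le0; apply: (le_of_small _ _ 3 1) => // e e0 _.
  have [d [x0' [x' [k' [_ _ X _ [h0 hh]]]]]] := h e e0.
  have [h1 h2] := hh t tT.
  have -> : x t + k t - (x0 + m t) = (x t - x' t) + (k t - k' t) - (x0 - x0').
    have E := aGSP_eq _ _ _ _ _ _ _ _ X t tT; apply: (dot_ext dot norm_dot) => v.
    have : dot (x' t + k' t) v = dot (x0' + m t) v by rewrite E.
    by rewrite !(dotDl, dotNl); lra.
  have := ler_normB ((x t - x' t) + (k t - k' t)) (x0 - x0').
  have := ler_normD (x t - x' t) (k t - k' t); lra.
move=> z zs Az s t s0 st tT; rewrite mul0r oppr0.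
have V0 : 0 <= V.
  by have := kV _ _ (partition_nil _ (ltW T0)); apply: le_trans; apply: sumr_ge0.
have t0 := le_trans s0 st.
have sub r : s <= r <= t -> 0 <= r <= T.
  by move=> /andP[h1 h2]; rewrite (le_trans s0 h1) (le_trans h2 tT).
apply: (le_of_small _ _ (2 * V) 1) => // e e0 _; rewrite -lerBlDr sub0r.
have xz : ucont s t (fun r => x r - z).
  by apply: (ucontW 0 T) => //; apply: ucontB => //; exact: ucont_cst.
have [C C0 hC] := RS_small _ _ _ _ st xz e0.
have vk := varf_ctrl _ _ _ kV.
apply: (le_of_small _ _ (2 * (V + `|zs| * T) + C) 1) => // d d0 _.
have [d' [x0' [x' [k' [d'0 d'd X vV [_ hh]]]]]] := h d d0.
have lin : ctrl s t (fun r => r *: zs) (fun r => r * `|zs|) by exact: ctrl_lin.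
have vk' := aGSP_ctrl _ _ _ _ _ _ _ _ X.
have vks : ctrl s t k (varf k) by exact: ctrlW vk.
have vk's : ctrl s t k' (varf k') by exact: ctrlW vk'.
have le_var g : var_le 0 T g V -> varf g T <= V -> varf g t - varf g s <= V.
  move=> gV gT; have gc := varf_ctrl _ _ _ gV.
  have := ctrl_mono _ _ _ _ _ _ gc t0 tT (lexx T).
  by have := ctrl_mono _ _ _ _ _ _ gc (lexx 0) s0 (le_trans st tT); rewrite varf0; lra.
have vkV := le_var k kV (varf_le_bound _ _ _ (ltW T0) kV).
have vk'V : varf k' t - varf k' s <= V.
  apply: le_var => //; have [B kB] := aGSP_bv _ _ _ _ _ _ _ _ X.
  by move=> n p P; exact: le_trans (vsum_varf _ _ _ _ _ (ltW T0) kB P) vV.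
have x'u := aGSP_x _ _ _ _ _ _ _ _ X.
have x'z : ucont s t (fun r => x' r - z).
  by apply: (ucontW 0 T) => //; apply: ucontB => //; exact: ucont_cst.
have xx' : ucont s t (fun r => x r - x' r).
  by apply: (ucontW 0 T) => //; exact: ucontB.
have k'c := ctrlB _ _ _ _ _ _ vk's lin; have kc := ctrlB _ _ _ _ _ _ vks lin.
have kk' := ctrlB _ _ _ _ _ _ vks vk's.
have rs f g w : ucont s t f -> ctrl s t g w -> rsable s t f g by move=> ? ?; split => //; exists w.
have E : RS dot s t (fun r => x r - z) (fun r => k r - r *: zs) =
   RS dot s t (fun r => x' r - z) (fun r => k' r - r *: zs) +
   RS dot s t (fun r => x r - x' r) (fun r => k' r - r *: zs) +
   RS dot s t (fun r => x r - z) (fun r => k r - k' r).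
  rewrite -RSDl//; [|exact: rs k'c|exact: rs k'c].
  have -> : RS dot s t (fun r => (x' r - z) + (x r - x' r)) (fun r => k' r - r *: zs) =
      RS dot s t (fun r => x r - z) (fun r => k' r - r *: zs).
    apply: (RS_ext dot norm_dot) => // [|r _]; first exact: rs k'c.
    by apply: (dot_ext dot norm_dot) => v; rewrite !(dotDl, dotNl); ring.
  apply/eqP; rewrite addrC -subr_eq -RSBr//; [|exact: rs kc|exact: rs k'c].
  apply/eqP; apply: (RS_ext dot norm_dot) => //; first exact: rs kk'.
  by move=> r r' _ _ _; apply: (dot_ext dot norm_dot) => v; rewrite !dotE; ring.
have h1 := aGSP_ineq _ _ _ _ _ _ _ _ X z zs Az s t s0 st tT.
have h2 := RS_bound dot norm_dot _ _ _ _ _ _ st xx' k'c (fun r rt => (hh r (sub r rt)).1).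
have h3 : `|RS dot s t (fun r => x r - z) (fun r => k r - k' r)| <= e * (2 * V) + C * d.
  by apply: (hC _ _ _ _ kk') => [|r rt]; [lra|exact: (hh r (sub r rt)).2].
have W0 : 0 <= varf k' t - varf k' s.
  by rewrite subr_ge0; exact: (ctrl_mono _ _ _ _ _ _ vk').
have zsT : `|zs| * (t - s) <= `|zs| * T by rewrite ler_wpM2l//; lra.
have zs0 : 0 <= `|zs| * (t - s) by rewrite mulr_ge0// subr_ge0.
have h4 : d' * (varf k' t - varf k' s + `|zs| * (t - s)) <= d * (V + `|zs| * T).
  by apply: ler_pM => //; [exact: addr_ge0|exact: lerD].
have h5 : d * (varf k' t + t * `|zs| - (varf k' s + s * `|zs|)) <= d * (V + `|zs| * T).
  rewrite ler_wpM2l ?(ltW d0)//; lra.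
rewrite E; move: h1 h2 h3 h4 h5; rewrite !ler_norml => + /andP[+ _] /andP[+ _].
by set q1 := RS _ _ _ _ _; set q2 := RS _ _ _ _ _; set q3 := RS _ _ _ _ _; lra.
Qed.

Lemma cell_of T n t : (0 < n)%N -> 0 <= t -> t <= grid 0 T n n ->
  exists2 i, (i < n)%N & grid 0 T n i <= t <= grid 0 T n i.+1.
Proof.
move=> n0 t0; suff : forall j, (0 < j <= n)%N -> t <= grid 0 T n j ->
    exists2 i, (i < n)%N & grid 0 T n i <= t <= grid 0 T n i.+1.
  by apply; rewrite n0 leqnn.
elim=> // j ih /= jn tj; have [jt|jt] := leP (grid 0 T n j) t.
  by exists j => //; rewrite jt.
apply: ih (ltW jt); rewrite (ltnW jn) andbT lt0n; apply/eqP => j0.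
by move: jt; rewrite j0 grid0 ltNge t0.
Qed.

Lemma euler_dom T d x0 m k t : 0 <= t <= T -> euler A T d x0 m k ->
  exists2 xi, Dom A xi & `|x0 + m t - k t - xi| <= d.
Proof.
move=> /andP[t0 tT] [n [xi [eta [n0 _ Axi h]]]].
have [|i ni it] := cell_of T n t n0 t0; first by rewrite gridn.
by exists (xi i); [exists (eta i); exact: Axi|exact: (h i ni t it).2].
Qed.

End limits.

(** * Existence, uniqueness and stability *)

Section well_posedness.
Context {R : realType} {H : completeNormedModType R} (dot : {dot H for idfun})
  (norm_dot : forall u : H, `|u| ^+ 2 = dot u u) (A : set (H * H))
  (A_max : maximal_monotone dot A).
Implicit Types (m k : R -> H).
Context (u0 : H) (rho mu : R) (rho0 : 0 < rho) (mu0 : 0 <= mu)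
  (support : forall d : H, exists z zs, [/\ A (z, zs), rho * `|d| <= dot (z - u0) d,
    `|z - u0| <= 3 * rho & `|zs| <= mu]).
Context (T : R) (T0 : 0 < T).

Definition small_osc N m := forall i, (i < N)%N ->
  forall r, grid 0 T N i <= r <= grid 0 T N i.+1 -> `|m r - m (grid 0 T N i)| <= rho / 4.

(** The hypothesis [hC] is the conclusion of [apriori]: the variation of the
    approximations is bounded whatever their error [e]. *)
Lemma euler_near N C x0 m (e : R) :
  (forall d x0 m x k, aGSP dot A T d x0 m x k -> 0 <= d -> d <= rho / 4 -> m 0 = 0 ->
    small_osc N m -> (forall t, 0 <= t <= T -> `|x t| ^+ 2 <= C * (1 + `|x0| ^+ 2)) /\
    varf k T <= C * (1 + `|x0| ^+ 2)) -> 1 <= C ->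
  closure (Dom A) x0 -> ucont 0 T m -> m 0 = 0 -> small_osc N m ->
  0 < e -> e <= Num.min 1 (rho / 4) ->
  exists x0' K, [/\ `|x0 - x0'| <= e, euler A T e x0' m K,
    aGSP dot A T e x0' m (fun t => x0' + m t - K t) K &
    varf K T <= C * (3 + 2 * `|x0| ^+ 2)].
Proof.
move=> hC C1 x0A mc m0 osc e0; rewrite le_min => /andP[e1 er].
have [x0' [Ax0' xx']] := x0A (ball x0 e) (nbhsx_ballx x0 e e0).
move: xx'; rewrite -ball_normE /= => /ltW xx'.
have [K EK] := euler_exists dot norm_dot A A_max T x0' m e T0 Ax0' mc m0 e0.
have X := euler_aGSP dot norm_dot A A_max.1 T e x0' m K T0 (ltW e0) mc EK.
exists x0', K; split => //.
have [_ h] := hC _ _ _ _ _ X (ltW e0) er m0 osc; apply: le_trans h _.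
rewrite ler_wpM2l//; first lra.
have := sqr_normD_le dot norm_dot x0 (- (x0 - x0')); rewrite normrN opprB addrCA subrr addr0.
have : `|x0 - x0'| ^+ 2 <= 1 by rewrite expr_le1// (le_trans xx').
lra.
Qed.

(** Both solutions are compared with Euler approximations of the second one,
    whose error [e] then tends to [0]. *)
Lemma stability N : (0 < N)%N -> exists2 C, 1 <= C & forall x0 x0' m m' x k x' k' (theta : R),
  closure (Dom A) x0' -> aGSP dot A T 0 x0 m x k -> aGSP dot A T 0 x0' m' x' k' ->
  m 0 = 0 -> m' 0 = 0 -> small_osc N m -> small_osc N m' ->
  (forall t, 0 <= t <= T -> `|m t - m' t| <= theta) ->
  [/\ forall t, 0 <= t <= T -> `|x t| ^+ 2 <= C * (1 + `|x0| ^+ 2),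
      varf k T <= C * (1 + `|x0| ^+ 2) &
  forall t, 0 <= t <= T -> `|x t - x' t - (m t - m' t)| ^+ 2 <=
    2 * `|x0 - x0'| ^+ 2 + 4 * theta * (C * (5 + `|x0| ^+ 2 + 3 * `|x0'| ^+ 2))].
Proof.
move=> N0; have [C C1 hC] := apriori dot norm_dot A u0 rho mu rho0 mu0 support T T0 N N0.
exists C => // x0 x0' m m' x k x' k' theta x0'A X X' m0 m'0 osc osc' mth.
have r4 : 0 <= rho / 4 by rewrite divr_ge0// ltW.
have [hx hk] := hC _ _ _ _ _ X (lexx 0) r4 m0 osc.
have [_ hk'] := hC _ _ _ _ _ X' (lexx 0) r4 m'0 osc'.
split => // t tT; set B := C * _; set D := `|x0 - x0'|.
have th0 : 0 <= theta.
  by rewrite (le_trans (normr_ge0 (m 0 - m' 0)))// mth// lexx ltW.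
have min0 : 0 < Num.min 1 (rho / 4) by rewrite lt_min ltr01 divr_gt0.
apply: (le_of_small _ _ (2 * (2 * D + 1 + 2 * B) + 2 * (1 + 2 * B)) _ min0) => e e0 emin.
have mc' := aGSP_m _ _ _ _ _ _ _ _ X'.
have [x1 [K [x01 EK Y hK]]] := euler_near N C x0' m' e hC C1 x0'A mc' m'0 osc' e0 emin.
have e1 : e <= 1 by move: emin; rewrite le_min => /andP[].
have ee : e ^+ 2 <= e by rewrite expr2 ler_piMl// ltW.
have d0 := ltW e0.
have Cx : 0 <= C * `|x0| ^+ 2 by rewrite mulr_ge0// (le_trans _ C1).
have Cx' : 0 <= C * `|x0'| ^+ 2 by rewrite mulr_ge0// (le_trans _ C1).
have B1 : varf k T + varf K T <= B by move: hk hK Cx Cx' C1; rewrite /B; lra.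
have B2 : varf k' T + varf K T <= B by move: hk' hK Cx Cx' C1; rewrite /B; lra.
have h1 := comparison dot norm_dot A A_max.1 T 0 e x0 x1 m m' x k K theta T0 (lexx 0) d0 X mc' EK mth t tT.
have mm s : 0 <= s <= T -> `|m' s - m' s| <= 0 by rewrite subrr normr0.
have h2 := comparison dot norm_dot A A_max.1 T 0 e x0' x1 m' m' x' k' K 0 T0 (lexx 0) d0 X' mc' EK mm t tT.
rewrite subrr subr0 in h2.
set P := x t - _ - _ in h1; set Q := x' t - _ in h2.
have -> : x t - x' t - (m t - m' t) = P - Q.
  by apply: (dot_ext dot norm_dot) => v; rewrite /P /Q !(dotDl, dotNl); ring.
have h3 := sqr_normD_le dot norm_dot P (- Q); rewrite normrN in h3.
have h4 : `|x0 - x1| ^+ 2 <= D ^+ 2 + (2 * D + 1) * e.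
  have h5 : `|x0 - x1| <= D + e.
    rewrite (_ : x0 - x1 = (x0 - x0') + (x0' - x1)); last by rewrite addrA subrK.
    by rewrite (le_trans (ler_normD _ _))// lerD2l.
  have h6 : `|x0 - x1| ^+ 2 <= (D + e) ^+ 2.
    by rewrite ler_pXn2r ?nnegrE// addr_ge0// /D.
  by move: h6 ee; rewrite sqrrD; lra.
have h5 : `|x0' - x1| ^+ 2 <= e.
  by apply: le_trans ee; rewrite ler_pXn2r ?nnegrE.
have h6 : (theta + 0 + e) * (varf k T + varf K T) <= (theta + 0 + e) * B.
  by rewrite ler_wpM2l// addr_ge0// addr0.
have h7 : (0 + 0 + e) * (varf k' T + varf K T) <= (0 + 0 + e) * B.
  by rewrite ler_wpM2l// !add0r.
move: h1 h2 h3 h4 h5 h6 h7; lra.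
Qed.

(** Euler approximations with errors tending to [0] form a uniformly Cauchy
    sequence, by comparison of each with the others. *)
Lemma existence N x0 m : (0 < N)%N -> closure (Dom A) x0 -> ucont 0 T m -> m 0 = 0 ->
  small_osc N m -> exists x k, GSP dot A T x0 m x k.
Proof.
move=> N0 x0A mc m0 osc.
have [C C1 hC] := apriori dot norm_dot A u0 rho mu rho0 mu0 support T T0 N N0.
pose e0 := Num.min 1 (rho / 4).
have e00 : 0 < e0 by rewrite lt_min ltr01 divr_gt0.
pose e n := e0 * n.+1%:R^-1.
have e_gt0 n : 0 < e n by rewrite mulr_gt0// invr_gt0.
have e_le n : e n <= e0 by rewrite ler_piMr ?(ltW e00)// invf_le1// ler1n.
have e1 n : e n <= 1 by apply: le_trans (e_le n) _; rewrite ge_min lexx.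
have e_cvg : e @ \oo --> (0 : R).
  by rewrite -[X in _ --> X](mulr0 e0); apply: cvgMr harmonic_cvg.
pose V := C * (3 + 2 * `|x0| ^+ 2).
have V0 : 0 <= V by rewrite mulr_ge0 ?addr_ge0 ?mulr_ge0// (le_trans _ C1).
have /choice[s hs] n : exists s : H * (R -> H), [/\ `|x0 - s.1| <= e n,
    euler A T (e n) s.1 m s.2,
    aGSP dot A T (e n) s.1 m (fun t => s.1 + m t - s.2 t) s.2 & varf s.2 T <= V].
  have [x0' [K [? ? ? ?]]] := euler_near N C x0 m (e n) hC C1 x0A mc m0 osc (e_gt0 n) (e_le n).
  by exists (x0', K).
pose X n t := (s n).1 + m t - (s n).2 t.
pose c := 2 + 4 * V.
have c0 : 0 < c by rewrite /c; lra.
have XX n l t : 0 <= t <= T -> `|X n t - X l t| ^+ 2 <= c * e n + c * e l.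
  move=> tT; have [xn En Xn Vn] := hs n; have [xl El Xl Vl] := hs l.
  have mm r : 0 <= r <= T -> `|m r - m r| <= 0 by rewrite subrr normr0.
  have := comparison dot norm_dot A A_max.1 T _ _ _ _ _ _ _ _ _ 0 T0 (ltW (e_gt0 n))
    (ltW (e_gt0 l)) Xn mc El mm t tT.
  rewrite subrr subr0 -/(X n t) -/(X l t) add0r => h1.
  have h2 : `|(s n).1 - (s l).1| ^+ 2 <= 2 * (e n + e l).
    have : `|(s n).1 - (s l).1| <= e n + e l.
      rewrite (_ : _ - _ = (x0 - (s l).1) - (x0 - (s n).1)); last first.
        by apply: (dot_ext dot norm_dot) => v; rewrite !(dotDl, dotNl); ring.
      by rewrite (le_trans (ler_normB _ _))// addrC lerD.
    have en := ltW (e_gt0 n); have el := ltW (e_gt0 l).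
    move=> h; apply: (@le_trans _ _ ((e n + e l) ^+ 2)).
      by rewrite ler_pXn2r ?nnegrE// addr_ge0.
    rewrite expr2 ler_wpM2r ?addr_ge0//; have := e1 n; have := e1 l; lra.
  have h3 : (e n + e l) * (varf (s n).2 T + varf (s l).2 T) <= (e n + e l) * (V + V).
    by rewrite ler_wpM2l ?addr_ge0 ?(ltW (e_gt0 _))// lerD.
  by move: h1 h2 h3; rewrite /c; lra.
have ce_cvg : (fun n => c * e n) @ \oo --> (0 : R).
  by rewrite -[X in _ --> X](mulr0 c); apply: cvgMr e_cvg.
pose x t := lim (X ^~ t @ \oo).
have Xx n t : 0 <= t <= T -> `|x t - X n t| ^+ 2 <= c * e n.
  move=> tT; have Xc : X ^~ t @ \oo --> x t.
    have : cvgn (X ^~ t) by apply: cvgn_sqr_cauchy ce_cvg => i j; exact: XX.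
    by [].
  have h1 : (fun l => `|X l t - X n t| ^+ 2) @ \oo --> `|x t - X n t| ^+ 2.
    by apply: cvgM; apply: cvg_norm; apply: cvgB => //; exact: cvg_cst.
  have h2 : (fun l => c * e l + c * e n) @ \oo --> 0 + c * e n.
    by apply: cvgD => //; exact: cvg_cst.
  rewrite -[leRHS]add0r; apply: (ler_cvg_to h1 h2); near=> l; exact: XX.
pose k t := x0 + m t - x t.
have approx (d : R) : 0 < d -> exists n, [/\ e n <= d, `|x0 - (s n).1| <= d &
    forall t, 0 <= t <= T -> `|x t - X n t| <= d /\ `|k t - (s n).2 t| <= d].
  move=> d0; have d2 : 0 < d / 2 by rewrite divr_gt0.
  have en2 : \forall n \near \oo, e n < d / 2 by apply: cvgr_lt e_cvg _ _.
  have cn2 : \forall n \near \oo, c * e n < (d / 2) ^+ 2.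
    by apply: cvgr_lt ce_cvg _ _; rewrite exprn_gt0.
  near \oo => n; exists n.
  have en : e n < d / 2 by near: n.
  have cn : c * e n < (d / 2) ^+ 2 by near: n.
  have [xn _ _ _] := hs n.
  have hX t : 0 <= t <= T -> `|x t - X n t| <= d / 2.
    move=> tT; rewrite -(@ler_pXn2r _ 2)// ?nnegrE ?(ltW d2)//.
    exact: le_trans (Xx n t tT) (ltW cn).
  split; [lra|by apply: le_trans xn _; lra|move=> t tT; have := hX t tT; split; first lra].
  rewrite (_ : k t - (s n).2 t = (x0 - (s n).1) - (x t - X n t)); last first.
    by apply: (dot_ext dot norm_dot) => v; rewrite /k /X !(dotDl, dotNl); ring.
  by rewrite (le_trans (ler_normB _ _))//; lra.
exists x, k; apply: aGSP_GSP => //; first exact: ltW.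
  apply: (aGSP_limit dot norm_dot A T V x0 m x k T0) => d /approx[n [end_ xn hn]].
  by have [_ _ Xn Vn] := hs n; exists (e n), (s n).1, (X n), (s n).2; split => //; exact: ltW.
move=> t tT U /nbhs_ballP[d /= d0 dU].
have d2 : 0 < d / 3 by rewrite divr_gt0.
have [n [en _ hn]] := approx _ d2.
have [_ En _ _] := hs n.
have [xi Axi hxi] := euler_dom A T _ _ m _ t tT En.
exists xi; split => //; apply: dU; rewrite -ball_normE /=.
rewrite (_ : x t - xi = (x t - X n t) + (X n t - xi)); last by rewrite addrA subrK.
rewrite (le_lt_trans (ler_normD _ _))//; have [h1 _] := hn t tT.
by move: hxi; rewrite -/(X n t); lra.
Unshelve. all: by end_near. Qed.

Lemma uniqueness N x0 m x k x' k' : (0 < N)%N -> closure (Dom A) x0 ->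
  m 0 = 0 -> small_osc N m ->
  GSP dot A T x0 m x k -> GSP dot A T x0 m x' k' ->
  forall t, 0 <= t <= T -> x' t = x t /\ k' t = k t.
Proof.
move=> N0 x0A m0 osc X X' t tT; have [C C1 hC] := stability N N0.
have mm s : 0 <= s <= T -> `|m s - m s| <= 0 by rewrite subrr normr0.
have aX := GSP_aGSP dot norm_dot A _ _ _ _ _ X.
have aX' := GSP_aGSP dot norm_dot A _ _ _ _ _ X'.
have [_ _ /(_ t tT)] := hC _ _ _ _ _ _ _ _ 0 x0A aX' aX m0 m0 osc osc mm.
rewrite !subrr normr0 subr0 expr0n /= !mulr0 mul0r addr0 => h.
have xx : x' t = x t.
  apply/subr0_eq/eqP; rewrite -normr_eq0 -sqrf_eq0; apply/eqP/le_anti.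
  by rewrite h sqr_ge0.
split => //; apply: (addrI (x' t)).
by rewrite {2}xx (GSP_eq X')// (GSP_eq X).
Qed.

End well_posedness.

(** The square root of the bound of [stability]; [theta <= 2 K] turns the
    summand [theta], which comes from [m - m'], into a multiple of its square
    root. *)
Lemma sqrt_bound {R : realType} (C K n n' D theta u : R) : 1 <= C -> 0 <= K ->
  0 <= n -> 0 <= n' -> 0 <= D -> 0 <= theta -> theta <= 2 * K -> 0 <= u ->
  u ^+ 2 <= 2 * D ^+ 2 + 4 * theta * (C * (5 + n ^+ 2 + 3 * n' ^+ 2)) ->
  u + theta <= (6 * C + 2 * K + 3) * (1 + n + n') * (D + Num.sqrt theta).
Proof.
move=> C1 K0 n0 n'0 D0 th0 thK u0 hu.
set q := Num.sqrt _; set a := 1 + n + n'.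
have q0 : 0 <= q by exact: sqrtr_ge0.
have q2 : q ^+ 2 = theta by rewrite sqr_sqrtr.
have a1 : 1 <= a by rewrite /a -addrA lerDl addr_ge0.
pose kappa := 2 * K + 1.
have kappa0 : 0 <= kappa by rewrite /kappa; lra.
have qk : q <= kappa.
  rewrite -(@ler_pXn2r _ 2)// ?nnegrE// q2 (le_trans thK)// /kappa sqrrD.
  by have := sqr_ge0 (2 * K); lra.
have tq : theta <= kappa * q by rewrite -q2 expr2 ler_wpM2r.
have aq : 0 <= a * q by rewrite mulr_ge0// (le_trans ler01).
have Caq : 0 <= C * (a * q) by rewrite mulr_ge0// (le_trans ler01).
have hB : C * (5 + n ^+ 2 + 3 * n' ^+ 2) <= (3 * C * a) ^+ 2.
  have h1 : 5 + n ^+ 2 + 3 * n' ^+ 2 <= 9 * a ^+ 2.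
    have n3 : 0 <= n * n' by rewrite mulr_ge0.
    have n4 : 0 <= n ^+ 2 by exact: sqr_ge0.
    have n5 : 0 <= n' ^+ 2 by exact: sqr_ge0.
    by move: n3 n4 n5; rewrite /a !expr2; lra.
  have a2 : 0 <= 9 * a ^+ 2 by rewrite mulr_ge0// sqr_ge0.
  have -> : (3 * C * a) ^+ 2 = C * (C * (9 * a ^+ 2)) by ring.
  rewrite ler_wpM2l ?(le_trans ler01)// (le_trans h1)// -[leLHS]mul1r.
  by rewrite ler_wpM2r.
have hz : u <= 2 * D + 6 * (C * (a * q)).
  rewrite -(@ler_pXn2r _ 2)// ?nnegrE//; last by lra.
  apply: le_trans hu _.
  have h1 : 4 * theta * (C * (5 + n ^+ 2 + 3 * n' ^+ 2)) <= 4 * theta * (3 * C * a) ^+ 2.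
    by rewrite ler_wpM2l// mulr_ge0.
  have h2 : 0 <= D * (C * (a * q)) by rewrite mulr_ge0.
  have h3 : 0 <= D ^+ 2 by exact: sqr_ge0.
  apply: (le_trans (lerD (lexx _) h1)); rewrite -q2.
  have -> : 4 * q ^+ 2 * (3 * C * a) ^+ 2 = (6 * (C * (a * q))) ^+ 2 by ring.
  by rewrite [leRHS]sqrrD; move: h2 h3; lra.
have aD : D <= a * D by rewrite ler_peMl.
have aC : 0 <= (6 * C + kappa) * (a * D).
  by apply: mulr_ge0; [lra|rewrite mulr_ge0// (le_trans ler01)].
have kq : kappa * q <= kappa * (a * q) by rewrite ler_wpM2l// ler_peMl.
by move: hz tq aD aC kq aq; rewrite /kappa; lra.
Qed.

Theorem theorem9 (R : realType) (H : completeNormedModType R)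
    (dot : {dot H for idfun}) (norm_dot : forall u : H, `|u| ^+ 2 = dot u u)
    (H_separable : separable H)
    (A : set (H * H)) (A_max : maximal_monotone dot A)
    (A_int : interior (Dom A) !=set0) :
  (forall (x0 : H) (m : R -> H),
     closure (Dom A) x0 -> {within `[0, +oo[, continuous m} -> m 0 = 0 ->
     forall T : R, 0 < T ->
       exists x k : R -> H,
         GSP dot A T x0 m x k /\
         forall x' k' : R -> H, GSP dot A T x0 m x' k' ->
           forall t : R, 0 <= t <= T -> x' t = x t /\ k' t = k t) /\
  (forall T : R, 0 < T ->
   forall M : set (R -> H), bounded_equicontinuous T M ->
   exists2 C : R, 0 < C &
     forall (x0 x0' : H) (m m' x k x' k' : R -> H),
       closure (Dom A) x0 -> closure (Dom A) x0' ->
       M m -> M m' -> m 0 = 0 -> m' 0 = 0 ->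
       GSP dot A T x0 m x k -> GSP dot A T x0' m' x' k' ->
       ((supnorm T x ^+ 2)%:E + vtotal_variation 0 T k
          <= (C * (1 + `|x0| ^+ 2))%:E)%E /\
       supnorm T (x \- x') <=
         C * (1 + `|x0| + `|x0'|) *
           (`|x0 - x0'| + Num.sqrt (supnorm T (m \- m')))).
Proof.
have [u0 [rho [mu [rho0 mu0 support]]]] := interior_support dot norm_dot A A_int.
have r4 : 0 < rho / 4 by rewrite divr_gt0.
split.
  move=> x0 m x0A mc m0 T T0.
  have mu' : ucont 0 T m.
    apply: within_ucont; apply: continuous_subspaceW mc => r /=.
    by rewrite !in_itv /= andbT => /andP[].
  have [d d0 hd] := mu' _ r4.
  have [N N0 /(_ m erefl) osc] := osc_grid T [set m] d _ T0 d0 ltac:(by move=> _ ->; exact: hd).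
  have [x [k X]] := existence dot norm_dot A A_max u0 rho mu rho0 mu0 support T T0 N x0 m N0 x0A mu' m0 osc.
  exists x, k; split => // x' k' X'.
  exact: (uniqueness dot norm_dot A A_max u0 rho mu rho0 mu0 support T T0 N x0 m x k x' k' N0).
move=> T T0 M [Mc [K MK] Meq].
have [d d0 hd] := equicontinuous_uniform 0 T M Meq _ r4.
have [N N0 osc] := osc_grid T M d _ T0 d0 hd.
have [C C1 hC] := stability dot norm_dot A A_max u0 rho mu rho0 mu0 support T T0 N N0.
have zero_in : 0 <= (0 : R) <= T by rewrite lexx ltW.
have sup0 (f : R -> H) : ucont 0 T f -> 0 <= supnorm T f.
  move=> fc; have [c _ fM] := ucont_max _ _ _ (ltW T0) fc.
  by apply: le_trans (supnorm_ge _ _ _ fM _ zero_in).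
have K0 := normr_ge0 K.
exists (6 * C + 2 * `|K| + 3); first by lra.
move=> x0 x0' m m' x k x' k' x0A x0'A Mm Mm' m0 m'0 X X'.
have aX := GSP_aGSP dot norm_dot A _ _ _ _ _ X.
have aX' := GSP_aGSP dot norm_dot A _ _ _ _ _ X'.
have mu' := within_ucont _ _ _ (Mc m Mm); have m'u := within_ucont _ _ _ (Mc m' Mm').
have mmu : ucont 0 T (m \- m') by exact: ucontB.
pose theta := supnorm T (m \- m').
have le_supnorm (f : R -> H) : ucont 0 T f -> forall t, 0 <= t <= T -> `|f t| <= supnorm T f.
  by move=> /(ucont_max _ _ _ (ltW T0))[c _ fM]; exact: supnorm_ge fM.
have mth t : 0 <= t <= T -> `|m t - m' t| <= theta by exact: le_supnorm _ mmu t.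
have [hx hk hd'] := hC _ _ _ _ _ _ _ _ theta x0'A aX aX' m0 m'0 (osc m Mm) (osc m' Mm') mth.
have xu := aGSP_x _ _ _ _ _ _ _ _ aX; have x'u := aGSP_x _ _ _ _ _ _ _ _ aX'.
split.
  have C0 : 0 <= C * (1 + `|x0| ^+ 2) by rewrite mulr_ge0 ?addr_ge0//; lra.
  have hS : supnorm T x ^+ 2 <= C * (1 + `|x0| ^+ 2).
    rewrite -[leRHS]sqr_sqrtr// ler_pXn2r ?nnegrE ?sqrtr_ge0 ?sup0//.
    apply: supnorm_le => [|t tT]; first exact: ltW.
    by rewrite -(@ler_pXn2r _ 2)// ?nnegrE ?sqrtr_ge0// sqr_sqrtr// hx.
  have hV : (vtotal_variation 0 T k <= (C * (1 + `|x0| ^+ 2))%:E)%E.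
    apply: vtotal_variation_le => [|n p P]; first exact: ltW.
    have [B kB] := aGSP_bv _ _ _ _ _ _ _ _ aX.
    exact: le_trans (vsum_varf _ _ _ _ _ (ltW T0) kB P) hk.
  apply: (@le_trans _ _ ((C * (1 + `|x0| ^+ 2))%:E + (C * (1 + `|x0| ^+ 2))%:E)%E).
    by apply: leeD => //; rewrite lee_fin.
  rewrite -EFinD lee_fin.
  have x2 : 0 <= `|x0| ^+ 2 by exact: sqr_ge0.
  have : 0 <= (4 * C + 2 * `|K| + 3) * (1 + `|x0| ^+ 2) by rewrite mulr_ge0//; lra.
  lra.
have th0 : 0 <= theta by exact: sup0.
have thK : theta <= 2 * `|K|.
  apply: supnorm_le => [|t tT]; first exact: ltW.
  apply: (le_trans (ler_normB _ _)).
  apply: (le_trans (lerD (le_supnorm _ mu' t tT) (le_supnorm _ m'u t tT))).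
  have := MK m Mm; have := MK m' Mm'; have := ler_norm K; lra.
apply: supnorm_le => [|t tT]; first exact: ltW.
have -> : (x \- x') t = (x t - x' t - (m t - m' t)) + (m t - m' t) by rewrite subrK.
apply: (le_trans (ler_normD _ _)); apply: (le_trans (lerD (lexx _) (mth t tT))).
exact: sqrt_bound C1 (normr_ge0 _) (normr_ge0 _) (normr_ge0 _) (normr_ge0 _)
  th0 thK (normr_ge0 _) (hd' t tT).
Qed.
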